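(* The following equalities of sets hold: $$\{n(X^* ) : X \text{ complex Banach space with } n(X)=1\}=[\mathrm{e}^{-1},1],$$ $$\{n(X^* ) : X \text{ real Banach space with } n(X)=1\}=[0,1].$$
   Context: For a real or complex Banach space $X$ with dual $X^*$ and unit sphere $S_X$, let $L(X)$ be the space of bounded linear operators on $X$. The numerical range of $T\in L(X)$ is $V(T)=\{x^*(Tx) : x\in S_X,\ x^*\in S_{X^*},\ x^*(x)=1\}$, the numerical radius is $v(T)=\sup\{|\lambda| : \lambda\in V(T)\}$, and the numerical index of $X$ is $n(X)=\inf\{v(T) : T\in L(X),\ \|T\|=1\}$. Here $\mathrm{e}$ is the base of the natural logarithm. *)

(* Defs.v *)
From HB Require Import structures.
From mathcomp Require Import all_boot all_order all_algebra.
From mathcomp Require Import all_classical all_reals all_analysis.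
From mathcomp Require Export complex.
Import Order.TTheory GRing.Theory Num.Theory.
Import numFieldNormedType.Exports.

Set Implicit Arguments.
Unset Strict Implicit.
Unset Printing Implicit Defensive.

Local Open Scope classical_set_scope.
Local Open Scope ring_scope.

(* In MathComp-Analysis the norm of a normedModType over K takes its values in
   K itself.  For K = R[i], z <= w means that w - z is real and nonnegative, so
   norms are nonnegative elements of the real line inside K, and [supremum] and
   [infimum] of sets of such elements are the usual real ones.  The structure
   below collects the scalar fields in which these suprema exist; R and R[i]
   are instances, so that the definitions that follow cover both cases. *)
HB.mixin Record NumField_hasSupremums K of Num.NumField K := {
  has_supremums : forall A : set K,
    A !=set0 -> ubound A !=set0 -> supremums A !=set0 }.

#[short(type="supNumFieldType")]
HB.structure Definition SupNumField :=
  {K of Num.NumField K & NumField_hasSupremums K}.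

Section RealInstance.
Variable R : realType.

Let real_has_supremums (A : set R) :
  A !=set0 -> ubound A !=set0 -> supremums A !=set0.
Proof.
move=> A0 Aub; exists (sup A); split.
  exact: sup_upper_bound (conj A0 Aub).
by move=> y Ay; apply: ge_sup.
Qed.

#[non_forgetful_inheritance]
HB.instance Definition _ := NumField_hasSupremums.Build R real_has_supremums.
End RealInstance.

Section ComplexInstance.
Variable R : realType.
Local Open Scope complex_scope.

Let complex_has_supremums (A : set R[i]) :
  A !=set0 -> ubound A !=set0 -> supremums A !=set0.
Proof.
move=> [a Aa] [u Au].
pose B := [set complex.Re z | z in A].
have leE (x y : R[i]) : (x <= y) =
    (complex.Im y == complex.Im x) && (complex.Re x <= complex.Re y).
  by case: x y => [x1 x2] [y1 y2].
have ImA z : A z -> complex.Im z = complex.Im u.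
  by move=> /Au; rewrite leE => /andP[/eqP ->].
have supB : has_sup B.
  split; first by exists (complex.Re a), a.
  by exists (complex.Re u) => _ [z /Au + <-]; rewrite leE => /andP[].
exists (sup B +i* complex.Im u); split.
  move=> z Az; rewrite leE /= (ImA _ Az) eqxx /=.
  by apply: sup_upper_bound => //; exists z.
move=> y Ay; rewrite leE /=; apply/andP; split.
  by have := Ay _ Aa; rewrite leE (ImA _ Aa) => /andP[].
apply: ge_sup; first by case: supB.
by move=> _ [z /Ay + <-]; rewrite leE => /andP[].
Qed.

HB.instance Definition _ :=
  NumField_hasSupremums.Build R[i] complex_has_supremums.
End ComplexInstance.

Section BoundedOperators.
Variables (K : supNumFieldType) (V W : normedModType K).

Definition is_bounded_operator (f : V -> W) : Prop :=
  linear f /\ exists M : K, forall x, `|f x| <= M * `|x|.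

Definition bounded_operator_pred : {pred V -> W} :=
  fun f => `[< is_bounded_operator f >].

Record bounded_operator := BoundedOperator {
  bounded_operator_fun :> V -> W;
  bounded_operatorP : bounded_operator_fun \in bounded_operator_pred }.

HB.instance Definition _ := [isSub for bounded_operator_fun].
HB.instance Definition _ := [Choice of bounded_operator by <:].

Let bounded_operator_submod : submod_closed bounded_operator_pred.
Proof.
split.
  apply/asboolP; split; first by move=> a x y; rewrite scaler0 addr0.
  by exists 0 => x; rewrite normr0 mul0r.
move=> a f g /asboolP[linf [M fM]] /asboolP[ling [N gN]].
apply/asboolP; split.
  move=> b x y; rewrite !fctE linf ling !scalerDr !scalerA (mulrC b a).
  by rewrite addrACA.
exists (`|a| * M + N) => x; rewrite !fctE mulrDl -mulrA.
by rewrite (le_trans (ler_normD _ _))// lerD// normrZ ler_wpM2l.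
Qed.

HB.instance Definition _ :=
  GRing.isSubmodClosed.Build K (V -> W)
    bounded_operator_pred bounded_operator_submod.
HB.instance Definition _ := [SubChoice_isSubLmodule of bounded_operator by <:].

Let bounded_operator_linear (f : bounded_operator) : linear f.
Proof. by have /asboolP[] := bounded_operatorP f. Qed.

HB.instance Definition _ (f : bounded_operator) :=
  GRing.isLinear.Build K V W _ f (bounded_operator_linear f).

Definition operator_norm (f : V -> W) : K :=
  supremum 0 [set `|f x| | x in [set x : V | `|x| <= 1]].

Lemma operator_norm_supremums (f : bounded_operator) :
  supremums [set `|f x| | x in [set x : V | `|x| <= 1]] (operator_norm f).
Proof.
set A := (X in supremums X).
have A0 : A !=set0 by exists `|f 0|, 0; rewrite //= normr0 ler01.
have [s sA] : supremums A !=set0.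
  apply: has_supremums => //.
  have /asboolP[_ [M fM]] := bounded_operatorP f.
  exists (`|M|) => _ [x /= x1 <-]; rewrite (le_trans (fM x))//.
  have [->|x0] := eqVneq x 0; first by rewrite normr0 mulr0.
  have xgt0 : 0 < `|x| by rewrite normr_gt0.
  have M0 : 0 <= M by rewrite -(pmulr_lge0 _ xgt0) (le_trans _ (fM x)).
  by rewrite ger0_norm// ler_piMr.
rewrite /operator_norm /supremum ifF; last by apply/negbTE/set0P.
by case: xgetP => // /(_ s).
Qed.

Lemma ler_operator_norm (f : bounded_operator) (x : V) :
  `|f x| <= operator_norm f * `|x|.
Proof.
have [->|x0] := eqVneq x 0; first by rewrite linear0 !normr0 mulr0.
have xgt0 : 0 < `|x| by rewrite normr_gt0.
have [ubf _] := operator_norm_supremums f.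
rewrite -ler_pdivrMr// mulrC -[X in X * _]ger0_norm ?invr_ge0//.
rewrite -normrZ -linearZ; apply: ubf; eexists; last reflexivity.
by rewrite /= normrZ ger0_norm ?invr_ge0// mulVf// gt_eqF.
Qed.

Lemma operator_norm_le (f : bounded_operator) (M : K) :
  (forall x, `|x| <= 1 -> `|f x| <= M) -> operator_norm f <= M.
Proof.
move=> fM; have [_] := operator_norm_supremums f; apply.
by move=> _ [x /= /fM + <-].
Qed.

Lemma operator_norm_ge0 (f : bounded_operator) : 0 <= operator_norm f.
Proof.
have [ubf _] := operator_norm_supremums f.
by rewrite (le_trans _ (ubf `|f 0| _))//; exists 0; rewrite //= normr0 ler01.
Qed.

Lemma operator_norm_ball (f : bounded_operator) (x : V) :
  `|x| <= 1 -> `|f x| <= operator_norm f.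
Proof. by have [ubf _] := operator_norm_supremums f => x1; apply: ubf; exists x. Qed.

Let operator_normD (f g : bounded_operator) :
  operator_norm (f + g : bounded_operator)
    <= operator_norm f + operator_norm g.
Proof.
apply: operator_norm_le => x x1.
by rewrite (le_trans (ler_normD _ _))// lerD// operator_norm_ball.
Qed.

Let operator_normZ (l : K) (f : bounded_operator) :
  operator_norm (l *: f : bounded_operator) = `|l| * operator_norm f.
Proof.
have le_normZ (a : K) (g : bounded_operator) :
    operator_norm (a *: g : bounded_operator) <= `|a| * operator_norm g.
  apply: operator_norm_le => x x1.
  by rewrite [X in `|X|](_ : _ = a *: g x)// normrZ ler_wpM2l// operator_norm_ball.
apply/le_anti/andP; split; first exact: le_normZ.
have [->|l0] := eqVneq l 0.
  by rewrite normr0 mul0r operator_norm_ge0.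
have lgt0 : 0 < `|l| by rewrite normr_gt0.
rewrite mulrC -ler_pdivlMr// mulrC -normfV.
by rewrite (le_trans _ (le_normZ _ _))// scalerA mulVf// scale1r.
Qed.

Let operator_norm0_eq0 (f : bounded_operator) : operator_norm f = 0 -> f = 0.
Proof.
move=> f0; apply/val_inj/funext => x; apply/normr0_eq0/le_anti.
by rewrite normr_ge0 andbT (le_trans (ler_operator_norm f x))// f0 mul0r.
Qed.

HB.instance Definition _ :=
  Lmodule_isNormed.Build K bounded_operator
    operator_normD operator_normZ operator_norm0_eq0.

Lemma bounded_operator_normE (f : bounded_operator) :
  `|f| = operator_norm f.
Proof. by []. Qed.

End BoundedOperators.

Definition dual (K : supNumFieldType) (X : normedModType K) : normedModType K :=
  bounded_operator X K^o.

Section NumericalIndex.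
Variables (K : supNumFieldType) (X : normedModType K).

Definition numerical_range (T : bounded_operator X X) : set K :=
  [set l | exists (x : X) (x' : bounded_operator X K^o),
    [/\ `|x| = 1, `|x'| = 1, x' x = 1 & l = x' (T x)]].

Definition numerical_radius (T : bounded_operator X X) : K :=
  supremum 0 [set `|l| | l in numerical_range T].

(* The infimum of the empty set is 0 by convention; it only occurs for the zero
   space, which therefore does not satisfy [numerical_index X = 1]. *)
Definition numerical_index : K :=
  infimum 0 [set numerical_radius T
            | T in [set T : bounded_operator X X | `|T| = 1]].

End NumericalIndex.

(* Main.v *)
(* Lower bound: if [v] is the numerical radius of [T], then [(1 - |z| v) |x + z T x|]
   is at most [(1 + |z|^2 |T|^2) |x|].  Iterating this bound on [(1 + z T / n)^n]
   and extracting the coefficient of [z] gives [|T| <= e v] for complex spaces;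
   the same bound shows that the numerical index depends continuously on the
   norm.

   Attained values: let [a], [b] be bounded families of scalars such that
   [sup |a_i p + b_i q|] is a norm on pairs [(p, q)], and let [X] be the space of
   functions [g(i, n) + a_i p + b_i q] on [I * nat] with [g] null at infinity,
   under the supremum norm.  Changing one value of a function shows [n(X) = 1].
   The dual [X'] of [X] is the l1-sum of an l1 space and of the dual of the plane of
   pairs, on which the operator [(p, q) |-> (q, tau p)] acts; this bounds [n(X')]
   from above.  The weights [exp(-|w|) (1, w)], for complex [w], with [tau = 0]
   give [1/e]; the unit circle with [tau = -1] (a rotation) gives [0] in the real
   case.  For the maximum norm on pairs, [X'] is an l1 space and [n(X') = 1].
   Joining the two norms by a segment and applying the intermediate value
   theorem yields every value in between. *)

(* An adjoint operator has the norm and the numerical radius of the operator it comes from. As n(X)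
   = 1, an operator on the dual whose radius is smaller than its norm therefore cannot be an
   adjoint: it has to act on what a functional sees at infinity. This is why each weight (a_i, b_i)
   is repeated along [nat]: deleting finitely many points does not change the norm of a pair, so the
   dual of the plane of pairs splits off in X', while in X single values can still be altered
   freely. The constant 1/e has two sources. From below, exp(r v) / r, the Cauchy bound at radius r,
   is least at r = 1/v, where it equals e v. From above, 1/e is the maximum of x exp(-x), which
   bounds the second weight and hence the norm of the pair (0, 1). The dual indices of the
   intermediate norms are never computed. It suffices that an isomorphism close to an isometry
   changes the index little, and that one equivalence constant serves for all norms on the
   segment. *)
Require Import Defs.
From HB Require Import structures.
From mathcomp Require Import all_boot all_order all_algebra.
From mathcomp Require Import all_classical all_reals all_analysis.
From mathcomp Require Import cyclic separable cyclotomic.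
From mathcomp Require Import complex.
From mathcomp Require Import ring lra.
Import Order.TTheory GRing.Theory Num.Theory.
Import numFieldNormedType.Exports.
Local Open Scope classical_set_scope.
Local Open Scope ring_scope.
Local Open Scope complex_scope.
Set Implicit Arguments.
Unset Strict Implicit.
Unset Printing Implicit Defensive.

(** * Real-valued norms, numerical radius and numerical index *)

(* Scalar fields, [R] and [R[i]] being the instances, with what the proof uses of
   them: norms are images of reals, Cauchy filters converge and Hahn-Banach holds. *)
Record scalars (R : realType) (K : supNumFieldType) := Scalars {
  emb :> {rmorphism R -> K};
  emb_le : forall a b, (emb a <= emb b) = (a <= b);
  emb_onto : forall x : K, 0 <= x -> exists a, x = emb a;
  emb_complete : forall F : set_system K, ProperFilter F ->
    (forall e : R, 0 < e -> exists x, F [set y | `|y - x| <= emb e]) ->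
    exists l, forall e : R, 0 < e -> F [set y | `|y - l| <= emb e];
  emb_support : forall (V : normedModType K) (y : V),
    exists2 f : bounded_operator V K^o, `|f| <= 1 & f y = `|y| }.

Section RealNorm.
Variables (R : realType) (K : supNumFieldType) (S : scalars R K).
Implicit Types V W : normedModType K.

(** The order of [R[i]] is only partial, so [lra] and [nra] do not apply to norms with values in
    [K]; their preimages in [R] make these tactics available. *)
Definition rnorm V (x : V) : R := sval (cid (emb_onto S (normr_ge0 x))).

Lemma rnormE V (x : V) : `|x| = S (rnorm x).
Proof. exact: (svalP (cid (emb_onto S (normr_ge0 x)))). Qed.

Lemma emb_inj : injective S.
Proof.
by move=> a b ab; apply/le_anti; rewrite -!(emb_le S) ab lexx.
Qed.

Lemma emb_ge0 a : (0 <= S a) = (0 <= a).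
Proof. by rewrite -[X in X <= _](rmorph0 S) emb_le. Qed.

Lemma emb_lt a b : (S a < S b) = (a < b).
Proof. by rewrite !lt_neqAle emb_le (inj_eq emb_inj). Qed.

Lemma emb_gt0 a : (0 < S a) = (0 < a).
Proof. by rewrite -[X in X < _](rmorph0 S) emb_lt. Qed.

Lemma emb_norm a : `|S a| = S `|a|.
Proof.
have [a0|a0] := leP 0 a; first by rewrite !ger0_norm// emb_ge0.
rewrite (ltr0_norm a0) rmorphN -normrN ger0_norm// -rmorphN emb_ge0.
by rewrite oppr_ge0 ltW.
Qed.

Lemma rnorm_unique V (x : V) a : `|x| = S a -> rnorm x = a.
Proof. by rewrite rnormE => /emb_inj. Qed.

Lemma rnorm_ge0 V (x : V) : 0 <= rnorm x.
Proof. by rewrite -emb_ge0 -rnormE. Qed.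

Lemma rnorm_emb a : rnorm (S a : K^o) = `|a|.
Proof. by apply: rnorm_unique; exact: emb_norm. Qed.

Lemma ler_rnormD V (x y : V) : rnorm (x + y) <= rnorm x + rnorm y.
Proof. by rewrite -(emb_le S) rmorphD -!rnormE ler_normD. Qed.

Lemma rnormZ V (a : K) (x : V) : rnorm (a *: x) = rnorm (a : K^o) * rnorm x.
Proof. by apply: rnorm_unique; rewrite rmorphM -!rnormE normrZ. Qed.

Lemma rnormM (a b : K) : rnorm (a * b : K^o) = rnorm (a : K^o) * rnorm (b : K^o).
Proof. exact: rnormZ. Qed.

Lemma rnormN V (x : V) : rnorm (- x) = rnorm x.
Proof. by apply: rnorm_unique; rewrite -rnormE normrN. Qed.

Lemma rnorm_distC V (x y : V) : rnorm (x - y) = rnorm (y - x).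
Proof. by rewrite -opprB rnormN. Qed.

Lemma ler_rnormB V (x y : V) : rnorm (x - y) <= rnorm x + rnorm y.
Proof. by rewrite -(rnormN y) ler_rnormD. Qed.

Lemma ler_rdist V (x y : V) : rnorm x - rnorm y <= rnorm (x - y).
Proof. by rewrite lerBlDr -{1}(subrK y x) ler_rnormD. Qed.

Lemma rnorm0 V : rnorm (0 : V) = 0.
Proof. by apply: rnorm_unique; rewrite normr0 rmorph0. Qed.

Lemma rnorm1 : rnorm (1 : K^o) = 1.
Proof. by rewrite -(rmorph1 S) rnorm_emb normr1. Qed.

Lemma rnorm_eq0 V (x : V) : (rnorm x == 0) = (x == 0).
Proof.
apply/eqP/eqP => [x0|->]; last exact: rnorm0.
by apply/normr0_eq0; rewrite rnormE x0 rmorph0.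
Qed.

Lemma rnorm_gt0 V (x : V) : (0 < rnorm x) = (x != 0).
Proof. by rewrite lt_neqAle rnorm_ge0 andbT eq_sym rnorm_eq0. Qed.

Lemma rnormZ_emb V a (x : V) : rnorm (S a *: x) = `|a| * rnorm x.
Proof. by rewrite rnormZ rnorm_emb. Qed.

Lemma rnorm_sum V (I : Type) (r : seq I) (F : I -> V) :
  rnorm (\sum_(i <- r) F i) <= \sum_(i <- r) rnorm (F i).
Proof.
elim/big_ind2: _ => [|x a y b xa yb|//]; first by rewrite rnorm0.
by rewrite (le_trans (ler_rnormD _ _)) ?lerD.
Qed.

Lemma rnorm_normalize V (x : V) : x != 0 -> rnorm (S (rnorm x)^-1 *: x) = 1.
Proof.
rewrite -rnorm_gt0 => x0.
by rewrite rnormZ_emb ger0_norm ?invr_ge0 ?rnorm_ge0// mulVf// gt_eqF.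
Qed.

Lemma phase (a : K) : exists u : K, rnorm (u : K^o) = 1 /\ u * a = S (rnorm (a : K^o)).
Proof.
have [->|a0] := eqVneq a 0.
  by exists 1; rewrite mulr0 rnorm0 rmorph0 rnorm1.
have na0 : rnorm (a : K^o) != 0 by rewrite rnorm_eq0.
exists (S (rnorm (a : K^o)) / a); split; last by rewrite divfK.
have : rnorm (a : K^o) * rnorm (a^-1 : K^o) = 1.
  by rewrite -rnormM divff// rnorm1.
by rewrite rnormM rnorm_emb ger0_norm ?rnorm_ge0.
Qed.

Definition mkop V W (f : V -> W) (M : R) (linf : linear f)
    (bf : forall x, rnorm (f x) <= M * rnorm x) : bounded_operator V W.
Proof.
exists f; apply/asboolP; split=> //; exists (S M) => x.
by rewrite !rnormE -rmorphM emb_le.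
Defined.

Lemma mkopE V W (f : V -> W) (M : R) (linf : linear f)
    (bf : forall x, rnorm (f x) <= M * rnorm x) x : mkop linf bf x = f x.
Proof. by []. Qed.

Lemma ler_oprnorm V W (T : bounded_operator V W) x :
  rnorm (T x) <= rnorm T * rnorm x.
Proof.
by rewrite -(emb_le S) rmorphM -!rnormE bounded_operator_normE ler_operator_norm.
Qed.

Lemma oprnorm_le V W (T : bounded_operator V W) M :
  (forall x, rnorm x <= 1 -> rnorm (T x) <= M) -> rnorm T <= M.
Proof.
move=> TM; rewrite -(emb_le S) -rnormE bounded_operator_normE.
apply: operator_norm_le => x; rewrite -(rmorph1 S) !rnormE !emb_le.
exact: TM.
Qed.

Lemma oprnorm_leM V W (T : bounded_operator V W) M : 0 <= M ->
  (forall x, rnorm (T x) <= M * rnorm x) -> rnorm T <= M.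
Proof.
move=> M0 TM; apply: oprnorm_le => x x1; apply: (le_trans (TM x)).
exact: ler_piMr.
Qed.

Lemma oprnorm_unit V W (T : bounded_operator V W) x :
  rnorm x <= 1 -> rnorm (T x) <= rnorm T.
Proof.
by move=> x1; apply: (le_trans (ler_oprnorm T x)); rewrite ler_piMr ?rnorm_ge0.
Qed.

Lemma support V (y : V) : y != 0 ->
  exists f : bounded_operator V K^o, rnorm f = 1 /\ f y = S (rnorm y).
Proof.
move=> y0; have [f f1 fy] := emb_support S y.
exists f; split; last by rewrite fy rnormE.
apply/le_anti/andP; split.
  by rewrite -(emb_le S) rmorph1 -rnormE.
have /= := ler_oprnorm f y.
rewrite fy rnormE rnorm_emb ger0_norm ?rnorm_ge0//.
by rewrite -[X in X <= _]mul1r ler_pM2r// rnorm_gt0.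
Qed.

End RealNorm.

(** * Numerical radius and numerical index as real numbers *)

Section RealIndex.
Variables (R : realType) (K : supNumFieldType) (S : scalars R K).
Variable X : normedModType K.
Implicit Types T : bounded_operator X X.
Local Notation N := (rnorm S).

(** The premise [0 <= m] in the last clause accounts for the empty set, whose supremum is 0 by
    default. *)
Lemma real_supremum (A : set K) M : (forall x, A x -> 0 <= x) ->
  (forall x, A x -> x <= S M) ->
  exists s : R, [/\ supremum 0 A = S s, 0 <= s,
   (forall a, A (S a) -> a <= s) &
   (forall m, 0 <= m -> (forall a, A (S a) -> a <= m) -> s <= m)].
Proof.
move=> Age0 AM; rewrite /supremum; case: ifPn => [/eqP A0|/set0P A0].
  by exists 0; rewrite rmorph0 lexx A0; split.
have [|t tA] := has_supremums _ A0; first by exists (S M) => x /AM.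
have := xgetI 0 tA; set y := xget _ _ => -[yub yle].
have y0 : 0 <= y.
  case: A0 => a Aa; apply: (le_trans (Age0 _ Aa)). exact: yub.
have [s sE] := emb_onto S y0.
rewrite -/y sE in yub yle y0 *; exists s; split => //.
- by rewrite -(emb_ge0 S).
- by move=> a Aa; rewrite -(emb_le S); exact: yub.
- move=> m m0 Am; rewrite -(emb_le S); apply: yle => x Ax.
  have [a aE] := emb_onto S (Age0 _ Ax).
  by rewrite aE emb_le; apply: Am; rewrite -aE.
Qed.

Lemma real_infimum (A : set K) : (forall x, A x -> 0 <= x) ->
  exists s : R, [/\ infimum 0 A = S s, 0 <= s,
   (forall a, A (S a) -> s <= a) &
   (forall m, A !=set0 -> (forall a, A (S a) -> m <= a) -> m <= s)].
Proof.
move=> Age0; rewrite /infimum; case: ifPn => [/eqP A0|/set0P A0].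
  by exists 0; rewrite rmorph0 lexx A0; split=> //  m [].
(* The scalar field provides suprema, so the infimum is obtained as minus a supremum of the opposite
   set. *)
have [||t [tub tle]] := @has_supremums K [set - x | x in A].
- by case: A0 => a Aa; exists (- a), a.
- by exists 0 => _ [a /Age0 a0 <-]; rewrite oppr_le0.
have tA : infimums A (- t).
  split; first by move=> a Aa; rewrite lerNl; apply: tub; exists a.
  move=> u ulb; rewrite lerNr; apply: tle => _ [a Aa <-].
  by rewrite lerN2; apply: ulb.
have := xgetI 0 tA; set y := xget _ _ => -[yub yle].
have y0 : 0 <= y by apply: yle => x /Age0.
have [s sE] := emb_onto S y0.
rewrite -/y sE in yub yle y0 *; exists s; split => //.
- by rewrite -(emb_ge0 S).
- by move=> a Aa; rewrite -(emb_le S); exact: yub.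
- move=> m _ Am; rewrite -(emb_le S); apply: yle => x Ax.
  have [a aE] := emb_onto S (Age0 _ Ax).
  by rewrite aE emb_le; apply: Am; rewrite -aE.
Qed.

Definition state (x : X) (f : bounded_operator X K^o) :=
  [/\ N x = 1, N f = 1 & f x = 1].

Lemma radius_spec (T : bounded_operator X X) :
  exists s : R, [/\ numerical_radius T = S s, 0 <= s,
   (forall x f, state x f -> N (f (T x) : K^o) <= s) &
   (forall m, 0 <= m ->
     (forall x f, state x f -> N (f (T x) : K^o) <= m) -> s <= m)].
Proof.
have unitE (V : normedModType K) (x : V) : `|x| = 1 <-> N x = 1.
  split=> [x1|x1]; first by apply: rnorm_unique; rewrite x1 rmorph1.
  by rewrite (rnormE S) x1 rmorph1.
have [||s [sE s0 sub sle]] :=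
    @real_supremum [set `|l| | l in numerical_range T] (N T).
- by move=> _ [l _ <-]; apply: normr_ge0.
- move=> _ [_ [x [f [/unitE x1 /unitE f1 fx ->]]] <-].
  rewrite (_ : `|_| = S (N (f (T x) : K^o))); last exact: rnormE.
  rewrite emb_le (le_trans (ler_oprnorm _ _ _))// f1 mul1r.
  by rewrite oprnorm_unit// x1.
exists s; split => //.
- move=> x f [/unitE x1 /unitE f1 fx]; apply: sub.
  by exists (f (T x)); [exists x, f | exact: rnormE].
- move=> m m0 Hm; apply: sle => // a [_ [x [f [/unitE x1 /unitE f1 fx ->]]] aE].
  by rewrite -(rnorm_unique aE); apply: Hm.
Qed.

Definition rradius T := sval (cid (radius_spec T)).

Lemma rradiusE T : numerical_radius T = S (rradius T).
Proof. by have [] := svalP (cid (radius_spec T)). Qed.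

Lemma rradius_ge0 T : 0 <= rradius T.
Proof. by have [] := svalP (cid (radius_spec T)). Qed.

Lemma rradius_ub T x f : state x f -> N (f (T x) : K^o) <= rradius T.
Proof. by have [_ _ + _] := svalP (cid (radius_spec T)); apply. Qed.

Lemma rradius_le T m : 0 <= m ->
  (forall x f, state x f -> N (f (T x) : K^o) <= m) -> rradius T <= m.
Proof. by have [_ _ _] := svalP (cid (radius_spec T)); apply. Qed.

Lemma rradius_le_norm T : rradius T <= N T.
Proof.
apply: rradius_le; first exact: rnorm_ge0.
move=> x f [x1 f1 _]; rewrite (le_trans (ler_oprnorm _ _ _))// f1 mul1r.
by rewrite oprnorm_unit// x1.
Qed.

Lemma index_spec :
  exists s : R, [/\ numerical_index X = S s, 0 <= s,
   (forall T, N T = 1 -> s <= rradius T) &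
   (forall m, (exists T : bounded_operator X X, N T = 1) ->
     (forall T, N T = 1 -> m <= rradius T) -> m <= s)].
Proof.
have unitE (T : bounded_operator X X) : `|T| = 1 <-> N T = 1.
  split=> [x1|x1]; first by apply: rnorm_unique; rewrite x1 rmorph1.
  by rewrite (rnormE S) x1 rmorph1.
have [|s [sE s0 sub sle]] := @real_infimum
    [set numerical_radius T | T in [set T : bounded_operator X X | `|T| = 1]].
  by move=> _ [T _ <-]; rewrite rradiusE emb_ge0 rradius_ge0.
exists s; split => //.
- by move=> T /unitE T1; apply: sub; exists T => //; apply: rradiusE.
- move=> m [T0 /unitE T01] Hm; apply: sle; first by exists (numerical_radius T0), T0.
  by move=> a [T /= /unitE T1]; rewrite rradiusE => /emb_inj <-; apply: Hm.
Qed.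

Definition rindex := sval (cid index_spec).

Lemma rindexE : numerical_index X = S rindex.
Proof. by have [] := svalP (cid (index_spec)). Qed.

Lemma rindex_ge0 : 0 <= rindex.
Proof. by have [] := svalP (cid (index_spec)). Qed.

Lemma rindex_le T : rindex * N T <= rradius T.
Proof.
have [->|T0] := eqVneq T 0; first by rewrite rnorm0 mulr0 rradius_ge0.
have t0 : 0 < N T by rewrite rnorm_gt0.
pose U : bounded_operator X X := S (N T)^-1 *: T.
have U1 : N U = 1 by apply: rnorm_normalize.
rewrite -ler_pdivlMr//; apply: (@le_trans _ _ (rradius U)).
  by have [_ _ /(_ U U1)] := svalP (cid index_spec).
apply: rradius_le; first by rewrite divr_ge0 ?rradius_ge0// ltW.
move=> x f xf; rewrite ler_pdivlMr// mulrC.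
have -> : U x = S (N T)^-1 *: T x by [].
rewrite linearZ rnormZ rnorm_emb ger0_norm ?invr_ge0 ?rnorm_ge0//.
by rewrite mulrA divff ?gt_eqF// mul1r; exact: rradius_ub xf.
Qed.

(** A nonzero vector gives the identity norm one, so the infimum is not over the empty set, where it
    would be 0. *)
Lemma rindex_ge m : (exists x : X, x != 0) ->
  (forall T, N T = 1 -> m <= rradius T) -> m <= rindex.
Proof.
move=> [x0 x00] mT.
have [T0 T01] : exists T : bounded_operator X X, N T = 1.
  have b (x : X) : N x <= 1 * N x by rewrite mul1r.
  have lin : linear (fun x : X => x) by [].
  exists (mkop lin b); apply/le_anti/andP; split.
    by apply: oprnorm_leM => // x; rewrite mul1r.
  have := ler_oprnorm S (mkop lin b) x0; rewrite mkopE.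
  by rewrite -{1}(mul1r (N x0)) ler_pM2r ?rnorm_gt0.
by have [_ _ _] := svalP (cid index_spec); apply=> //; exists T0.
Qed.

Lemma rindex_le1 : rindex <= 1.
Proof.
rewrite leNgt; apply/negP => s1; have [sE s0 sub sle] := svalP (cid index_spec).
have [T1|T0] := pselect (exists T : bounded_operator X X, N T = 1).
  case: T1 => T T1; have := sub T T1; rewrite -/rindex; have := rradius_le_norm T; rewrite T1; lra.
have : numerical_index X = 0.
  rewrite /numerical_index (_ : image _ _ = set0); first by rewrite /infimum eqxx.
  rewrite -subset0 => _ [T /= TE _]; apply: T0; exists T.
  by apply: rnorm_unique; rewrite TE rmorph1.
by rewrite rindexE -(rmorph0 S) => /emb_inj; lra.
Qed.

(** Without a nonzero functional there is no state, so all numerical radii vanish; a positive index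
    then makes every operator have norm 0, and the infimum over the empty set is 0, a
    contradiction. *)
Lemma rindex_gt0_dual : 0 < rindex -> exists f : dual X, f != 0.
Proof.
move=> i0; apply/not_existsP => H.
have T0 (T : bounded_operator X X) : N T = 0.
  apply/le_anti; rewrite rnorm_ge0 andbT.
  have : rradius T <= 0.
    apply: rradius_le => // x f [_ f1 _]; exfalso; apply: (H f).
    by rewrite -(rnorm_gt0 S) f1.
  move=> h; have := rindex_le T; move: i0 h (rnorm_ge0 S T); nra.
have : numerical_index X = 0.
  rewrite /numerical_index (_ : image _ _ = set0); first by rewrite /infimum eqxx.
  rewrite -subset0 => _ [T /= TE _].
  have := T0 T; rewrite (@rnorm_unique _ _ S _ T 1); last by rewrite TE rmorph1.
  by move/eqP; rewrite oner_eq0.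
by rewrite rindexE -(rmorph0 S) => /emb_inj; lra.
Qed.

End RealIndex.

(** * Perturbations of the identity *)

Section Perturbation.
Variables (R : realType) (K : supNumFieldType) (S : scalars R K).
Implicit Types X Y : normedModType K.
Local Notation N := (rnorm S).

(** From 1 = |f x| <= |f| |x| both norms equal one, and a unimodular multiple of [f] forms a state
    with [x]. *)
Lemma rradius_pair X (T : bounded_operator X X) x (f : bounded_operator X K^o) :
  N x <= 1 -> N f <= 1 -> N (f x : K^o) = 1 -> N (f (T x) : K^o) <= rradius S T.
Proof.
move=> x1 f1 fx; have [u [u1 ufx]] := phase S (f x : K).
rewrite fx rmorph1 in ufx.
pose g : bounded_operator X K^o := u *: f.
have gE y : g y = u * f y by [].
have g1 : N g <= 1 by rewrite rnormZ u1 mul1r.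
have gx : N (g x : K^o) = 1 by rewrite gE ufx rnorm1.
have := ler_oprnorm S g x; rewrite gx => h.
have st : state S x g.
  split; last by rewrite gE ufx.
  - by move: h (rnorm_ge0 S g) x1 g1 (rnorm_ge0 S x); nra.
  - by move: h (rnorm_ge0 S g) x1 g1 (rnorm_ge0 S x); nra.
by have := rradius_ub T st; rewrite gE rnormM u1 mul1r.
Qed.

Lemma rradius_support X (T : bounded_operator X X) x (f : bounded_operator X K^o) :
  N f <= 1 -> f x = S (N x) -> N (f (T x) : K^o) <= rradius S T * N x.
Proof.
move=> f1 fx; have [->|x0] := eqVneq x 0.
  by rewrite !linear0 !rnorm0 mulr0.
pose u := S (N x)^-1 *: x.
have nx : N x != 0 by rewrite rnorm_eq0.
have xE : x = S (N x) *: u by rewrite /u scalerA -rmorphM divff// rmorph1 scale1r.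
have fu : N (f u : K^o) = 1.
  by rewrite /u linearZ/= fx -[_ *: _]/(_ * _) -rmorphM mulVf// rmorph1 rnorm1.
have u1 : N u <= 1 by rewrite rnorm_normalize.
clearbody u; have h := rradius_pair T u1 f1 fu.
rewrite {1}xE !linearZ/= rnormZ_emb ger0_norm ?rnorm_ge0// mulrC.
by rewrite ler_wpM2r ?rnorm_ge0.
Qed.

(* Applying [1 - a T] to [x + a T x] gives [x - a^2 T^2 x], while a functional
   supporting [y] shows that [1 - a T] shrinks [y] by at most [1 - |a| v(T)]. *)
Lemma perturb_le X (T : bounded_operator X X) (a : K) x :
  (1 - N (a : K^o) * rradius S T) * N (x + a *: T x)
    <= (1 + N (a : K^o) ^+ 2 * N T ^+ 2) * N x.
Proof.
set y := x + _; have [y0|y0] := eqVneq y 0.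
  rewrite y0 rnorm0 mulr0 mulr_ge0 ?rnorm_ge0// addr_ge0// mulr_ge0//.
    by rewrite exprn_ge0// rnorm_ge0.
  by rewrite exprn_ge0// rnorm_ge0.
have [f [f1 fy]] := support S y0.
have f1' : N f <= 1 by rewrite f1.
have fT := rradius_support T f1' fy.
have yE : y - a *: T y = x - (a * a) *: T (T x).
  have -> : T y = T x + a *: T (T x) by rewrite /y linearD linearZ.
  by rewrite /y scalerDr scalerA opprD addrA addrK.
have up : N (y - a *: T y) <= N x + N (a : K^o) ^+ 2 * N T ^+ 2 * N x.
  rewrite yE (le_trans (ler_rnormB _ _ _))// lerD// rnormZ rnormM -expr2 -mulrA.
  rewrite ler_wpM2l ?sqr_ge0// (le_trans (ler_oprnorm _ _ _))//.
  by rewrite expr2 -mulrA ler_wpM2l ?rnorm_ge0// ler_oprnorm.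
have low : N y - N (a : K^o) * (rradius S T * N y) <= N (y - a *: T y).
  apply: (@le_trans _ _ (N (f (y - a *: T y) : K^o))); last first.
    by rewrite (le_trans (ler_oprnorm _ _ _))// f1 mul1r.
  have -> : f (y - a *: T y) = f y - a *: f (T y) by rewrite linearB linearZ.
  rewrite (le_trans _ (ler_rdist _ _ _))// fy rnorm_emb.
  rewrite ger0_norm ?rnorm_ge0// lerB// rnormZ.
  by rewrite ler_wpM2l ?rnorm_ge0.
lra.
Qed.

(** An operator [T] on [X] is carried to [U T U'] on [Y]. The distortion [h ^+ 2] is seen through a
    perturbation of the identity of size [h], so it enters the numerical radius divided by [h]: the
    index moves by the square root of the distortion. *)
Lemma rindex_perturb X Y (U : bounded_operator X Y) (U' : bounded_operator Y X)
    (A B h : R) :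
  (exists x : X, x != 0) -> cancel U U' -> cancel U' U ->
  0 <= A -> 0 <= B ->
  (forall x, N (U x) <= A * N x) -> (forall y, N (U' y) <= B * N y) ->
  0 < h -> h <= 2^-1 -> A * B <= 1 + h ^+ 2 ->
  rindex S Y <= rindex S X + 10 * h.
Proof.
move=> X0 UK U'K A0 B0 UA U'B h0 h1 AB.
rewrite -lerBlDr; apply: rindex_ge => // T T1.
set v := rradius S T.
have v0 : 0 <= v by apply: rradius_ge0.
have v1 : v <= 1 by rewrite -T1; apply: rradius_le_norm.
have linW : linear (U \o T \o U') by move=> a x y; rewrite /= !linearP.
have bW y : N ((U \o T \o U') y) <= A * B * N y.
  rewrite /= (le_trans (UA _))// -mulrA ler_wpM2l//.
  by rewrite (le_trans (ler_oprnorm _ _ _))// T1 mul1r.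
pose W := mkop linW bW.
have WE y : W y = U (T (U' y)) by [].
have NW : 1 <= (1 + h ^+ 2) * N W.
  apply: (@le_trans _ _ (A * B * N W)); last by rewrite ler_wpM2r ?rnorm_ge0.
  rewrite -T1; apply: oprnorm_leM; first by rewrite !mulr_ge0 ?rnorm_ge0.
  move=> x; rewrite -[T x]UK -{1}[x]UK -WE (le_trans (U'B _))//.
  rewrite [A * B]mulrC -!mulrA ler_wpM2l// (le_trans (ler_oprnorm _ _ _))//.
  by rewrite mulrCA ler_wpM2l ?rnorm_ge0.
have wv : rradius S W <= v + 7 * h.
  apply: rradius_le; first by move: v0 h0; lra.
  move=> y f [y1 f1 fy].
  set w := N _.
  have w0 : 0 <= w by apply: rnorm_ge0.
  have [u [u1 ufy]] := phase S (f (W y) : K).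
  (* The phase of [z] makes [f (y + z W y)] equal to [1 + h w], a lower bound for the norm of
     [y + z W y]; [perturb_le] bounds the pullback of this vector to [X] from above. *)
  set z := S h * u.
  have Nz : N (z : K^o) = h by rewrite rnormM u1 mulr1 rnorm_emb gtr0_norm.
  have := perturb_le T z (U' y); rewrite Nz T1 expr1n mulr1 -/v => p1.
  have p2 : 1 + h * w <= A * N (U' y + z *: T (U' y)).
    have -> : U' y + z *: T (U' y) = U' (y + z *: W y).
      by rewrite linearD linearZ/= UK.
    rewrite (le_trans _ (UA _))// U'K.
    have := ler_oprnorm S f (y + z *: W y); rewrite f1 mul1r.
    have -> : f (y + z *: W y) = f y + z * f (W y) by rewrite linearD linearZ.
    rewrite fy /z -mulrA ufy.
    by rewrite -rmorphM -(rmorph1 S) -rmorphD rnorm_emb ger0_norm ?addr_ge0 ?mulr_ge0// ltW.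
  have := U'B y; rewrite y1 mulr1 => p3.
  have p4 : (1 - h * v) * (1 + h * w) <= (1 + h ^+ 2) * (1 + h ^+ 2).
    have q : 0 <= 1 - h * v by nra.
    apply: (le_trans (ler_wpM2l q p2)).
    rewrite mulrCA (le_trans (ler_wpM2l A0 p1))//.
    rewrite mulrCA ler_wpM2l//; first by nra.
    by apply: le_trans AB; rewrite ler_wpM2l.
  have p5 : (1 - h * v) * w <= v + 2 * h + h ^+ 3.
    rewrite -(ler_pM2l h0); move: p4; lra.
  have p6 : h ^+ 3 <= h / 4.
    have : h ^+ 2 <= 4^-1 by nra.
    by move=> ?; rewrite exprS ler_wpM2l// ltW.
  have hv : h * v <= h by nra.
  have w2 : w <= 2 * v + 5 * h by nra.
  have : h * v * w <= h * (2 * v + 5 * h) by nra.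
  nra.
have := rindex_le S W; move: (rindex_ge0 S Y) (rindex_le1 S Y) => n0 n1 nW.
set n := rindex S Y in n0 n1 nW *.
have : n * 1 <= n * ((1 + h ^+ 2) * N W) by rewrite ler_wpM2l.
have : (1 + h ^+ 2) * (n * N W) <= (1 + h ^+ 2) * (v + 7 * h).
  by rewrite ler_wpM2l ?(le_trans nW)//; nra.
have : h ^+ 2 * v <= h ^+ 2 by nra.
have : h ^+ 2 <= h / 2 by nra.
have : h ^+ 2 * h <= h / 4 by nra.
lra.
Qed.

(* Every point of the ball is nearly a convex combination of two points at which
   [d] is unimodular.  On such points [d] and, in the bidual, evaluation are
   (up to a phase) support functionals, so [d] yields numerical index one both
   for a space that it norms and for a dual that it generates. *)
Definition splitting X (d : bounded_operator X K^o) :=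
  N d <= 1 /\ forall x e, N x <= 1 -> 0 < e -> exists x1 x2 s,
    [/\ N x1 <= 1 /\ N x2 <= 1, N (d x1 : K^o) = 1, N (d x2 : K^o) = 1,
        0 <= s <= 1 & N (x - (S s *: x1 + S (1 - s) *: x2)) <= e].

(** By convexity the bound at the two unimodular points passes to their combination; the tolerance
    [e / (1 + N g)] keeps the image of the remainder below [e]. *)
Lemma splitting_le X (d g : bounded_operator X K^o) m : splitting d ->
  (forall x, N x <= 1 -> N (d x : K^o) = 1 -> N (g x : K^o) <= m) -> N g <= m.
Proof.
move=> [d1 dx] gm; apply: oprnorm_le => x x1.
apply/ler_addgt0Pr => e e0.
have e'0 : 0 < e / (1 + N g) by rewrite divr_gt0// ltr_pwDl ?rnorm_ge0.
have [x2 [x3 [s [[x21 x31] dx2 dx3 /andP[s0 s1] err]]]] := dx x _ x1 e'0.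
set r := x - _ in err.
have -> : x = S s *: x2 + S (1 - s) *: x3 + r by rewrite /r addrC subrK.
have -> : g (S s *: x2 + S (1 - s) *: x3 + r) =
    (S s *: g x2 + S (1 - s) *: g x3) + g r by rewrite !linearD !linearZ.
rewrite (le_trans (ler_rnormD _ _ _))//.
have g2 := gm _ x21 dx2; have g3 := gm _ x31 dx3.
apply: lerD.
  rewrite (le_trans (ler_rnormD _ _ _))// !rnormZ_emb !ger0_norm ?subr_ge0//.
  by nra.
rewrite (le_trans (ler_oprnorm _ _ _))//.
rewrite (le_trans (ler_wpM2l (rnorm_ge0 _ _) err))//.
rewrite mulrA ler_pdivrMr ?ltr_pwDl ?rnorm_ge0// mulrC ler_wpM2l ?(ltW e0)//.
by rewrite lerDr.
Qed.

Lemma rindex1_norming X (D : set (bounded_operator X K^o)) :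
  (exists x : X, x != 0) -> (forall d, D d -> splitting d) ->
  (forall x m, (forall d, D d -> N (d x : K^o) <= m) -> N x <= m) ->
  rindex S X = 1.
Proof.
move=> X0 Dsplit Dnorm; apply/le_anti; rewrite rindex_le1/=.
apply: rindex_ge => // T T1; rewrite -T1; apply: oprnorm_le => x x1.
apply: Dnorm => d Dd; have [d1 _] := Dsplit d Dd.
have lindT : linear (d \o T : X -> K^o) by move=> a y z; rewrite /= !linearP.
have bdT y : N ((d \o T) y : K^o) <= 1 * N y.
  rewrite /= (le_trans (ler_oprnorm _ _ _))// (le_trans (ler_wpM2r _ d1)) ?rnorm_ge0//.
  by rewrite !mul1r (le_trans (ler_oprnorm _ _ _))// T1 mul1r.
have : N (mkop lindT bdT) <= rradius S T.
  apply: (splitting_le (Dsplit d Dd)) => y y1 dy.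
  exact: rradius_pair.
by apply: le_trans; apply: (oprnorm_unit (mkop lindT bdT)).
Qed.

Definition bidual_eval X (x : X) : bounded_operator (dual X) K^o.
Proof.
apply: (@mkop _ _ S (dual X) K^o (fun f : bounded_operator X K^o => f x) (N x)).
  by move=> a f g.
by move=> f; rewrite mulrC; apply: ler_oprnorm.
Defined.

Lemma rnorm_bidual_eval X (x : X) : N (bidual_eval x) <= N x.
Proof.
apply: oprnorm_leM; first exact: rnorm_ge0.
by move=> f; rewrite mulrC; exact: (ler_oprnorm S (f : bounded_operator X K^o) x).
Qed.

Lemma rindex1_dual_generating X (D : set (bounded_operator X K^o)) :
  (exists f : dual X, f != 0) -> (forall d, D d -> splitting d) ->
  (forall (T : bounded_operator (dual X) (dual X)) m, 0 <= m ->
     (forall d, D d -> N (T d) <= m) -> N T <= m) ->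
  rindex S (dual X) = 1.
Proof.
move=> X0 Dsplit Dgen; apply/le_anti; rewrite rindex_le1/=.
apply: rindex_ge => // T T1; rewrite -T1; apply: Dgen.
  exact: rradius_ge0.
move=> d Dd; apply: (splitting_le (Dsplit d Dd)) => x x1 dx.
apply: (@rradius_pair (dual X) T d (bidual_eval x)) => //.
  by have [] := Dsplit d Dd.
exact: le_trans (rnorm_bidual_eval x) x1.
Qed.

End Perturbation.

(** * The spaces attaining the values *)

Section NullFamilies.
Variables (R : realType) (K : supNumFieldType) (S : scalars R K) (I : choiceType).
Local Notation N := (rnorm S).

(** The c_0 condition on a discrete set of any cardinality; [I] will be the unit circle or the
    complex plane. *)
Definition vanishing (g : I * nat -> K^o) : Prop := forall e : R, 0 < e ->
  exists F : seq (I * nat), forall c, c \notin F -> N (g c) <= e.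

Definition vanishing_pred : {pred I * nat -> K^o} := fun g => `[< vanishing g >].

Record null_family := NullFamily {
  null_fun :> I * nat -> K^o;
  null_funP : null_fun \in vanishing_pred }.

HB.instance Definition _ := [isSub for null_fun].
HB.instance Definition _ := [Choice of null_family by <:].

Let vanishing_submod : submod_closed vanishing_pred.
Proof.
split.
  by apply/asboolP => e e0; exists [::] => c _; rewrite rnorm0 ltW.
move=> a f g /asboolP vf /asboolP vg; apply/asboolP => e e0.
have ha : 0 < 2 * (1 + N (a : K^o)) by rewrite mulr_gt0// ltr_pwDl ?rnorm_ge0.
have [|F1 HF1] := vf (e / (2 * (1 + N (a : K^o)))); first by rewrite divr_gt0.
have [|F2 HF2] := vg (e / 2); first by rewrite divr_gt0.
exists (F1 ++ F2) => c; rewrite mem_cat negb_or => /andP[/HF1 h1 /HF2 h2].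
rewrite fctE (le_trans (ler_rnormD _ _ _))// [e](splitr e) lerD//.
rewrite rnormZ (le_trans (ler_wpM2l (rnorm_ge0 S _) h1))//.
rewrite mulrA ler_pdivrMr// mulrCA [X in X <= _]mulrC.
have := rnorm_ge0 S (a : K^o); nra.
Qed.

HB.instance Definition _ := GRing.isSubmodClosed.Build K (I * nat -> K^o)
  vanishing_pred vanishing_submod.
HB.instance Definition _ := [SubChoice_isSubLmodule of null_family by <:].

Definition mknull g (vg : vanishing g) : null_family :=
  NullFamily (introT (asboolP _) vg : g \in vanishing_pred).

Lemma nullP (g : null_family) : vanishing g.
Proof. by have /asboolP := null_funP g. Qed.

Lemma null_lin a (f g : null_family) c : (a *: f + g) c = a * f c + g c.
Proof. by []. Qed.

Lemma null_inj (f g : null_family) : (forall c, f c = g c) -> f = g.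
Proof. by move=> fg; apply/val_inj/funext. Qed.

(** The weights a_i, b_i of a norm on pairs. [frame_low] makes this norm equivalent to the usual
    one; its constant is stored so that a whole path of norms can share it. In the applications the
    weight at [frame_pt] is (1, 0). *)
Record frame := Frame {
  frame_fst : I -> K;
  frame_snd : I -> K;
  frame_cst : R;
  frame_pt : I;
  frame_fst_le1 : forall i, N (frame_fst i : K^o) <= 1;
  frame_snd_le1 : forall i, N (frame_snd i : K^o) <= 1;
  frame_cst_ge0 : 0 <= frame_cst;
  frame_low : forall (p q : K) M,
    (forall i, N (frame_fst i * p + frame_snd i * q : K^o) <= M) ->
    N (p : K^o) <= frame_cst * M /\ N (q : K^o) <= frame_cst * M }.

Variable J : frame.

Definition lin (p q : K) (i : I) : K^o := frame_fst J i * p + frame_snd J i * q.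

Lemma lin_lin a p q p' q' i :
  lin (a * p + p') (a * q + q') i = a * lin p q i + lin p' q' i.
Proof. by rewrite /lin; ring. Qed.

Lemma lin_le p q i : N (lin p q i) <= N (p : K^o) + N (q : K^o).
Proof.
rewrite (le_trans (ler_rnormD _ _ _))// lerD// rnormM ler_piMl ?rnorm_ge0//.
  exact: frame_fst_le1.
exact: frame_snd_le1.
Qed.

(* The elements stand for the functions [ev x] on [I * nat]: a null family plus
   the function [lin p q], which is repeated infinitely often. *)
Definition xspace (f : frame) := (null_family * (K^o * K^o))%type.

HB.instance Definition _ (f : frame) := GRing.Lmodule.on (xspace f).

Definition ev (x : xspace J) (c : I * nat) : K^o := x.1 c + lin x.2.1 x.2.2 c.1.

Lemma ev_lin a (x y : xspace J) c : ev (a *: x + y) c = a * ev x c + ev y c.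
Proof.
rewrite /ev -[(_ + _).1]/(a *: x.1 + y.1) null_lin.
rewrite -[(_ + _).2.1]/(a * x.2.1 + y.2.1) -[(_ + _).2.2]/(a * x.2.2 + y.2.2).
by rewrite lin_lin; ring.
Qed.

Lemma null_bounded (g : null_family) : exists M, forall c, N (g c) <= M.
Proof.
have [|F HF] := nullP g (e := 1); first exact: ltr01.
exists (\sum_(c <- F) N (g c) + 1) => c.
have s0 (F' : seq (I * nat)) : 0 <= \sum_(c <- F') N (g c).
  by apply: sumr_ge0 => d _; apply: rnorm_ge0.
have [cF|/HF h] := boolP (c \in F); last by rewrite (le_trans h)// lerDr.
rewrite (big_rem c)//= -addrA lerDl addr_ge0//; exact: s0.
Qed.

Let xnorm_set (x : xspace J) : set R := [set N (ev x c) | c in setT].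

Lemma xnorm_has_sup x : has_sup (xnorm_set x).
Proof.
split; first by exists (N (ev x (frame_pt J, 0%N))), (frame_pt J, 0%N).
have [M HM] := null_bounded x.1.
exists (M + (N x.2.1 + N x.2.2)) => _ [c _ <-].
by rewrite (le_trans (ler_rnormD _ _ _))// lerD// lin_le.
Qed.

Definition xnorm (x : xspace J) : R := sup (xnorm_set x).

Lemma ev_le_xnorm x c : N (ev x c) <= xnorm x.
Proof. by apply: sup_upper_bound; [exact: xnorm_has_sup | exists c]. Qed.

Lemma xnorm_leP x M : (forall c, N (ev x c) <= M) -> xnorm x <= M.
Proof.
move=> H; apply: ge_sup; first by case: (xnorm_has_sup x).
by move=> _ [c _ <-].
Qed.

Lemma fresh (F : seq (I * nat)) i : exists n, (i, n) \notin F.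
Proof.
exists (\max_(c <- F) c.2).+1; apply/negP => /(map_f snd)/=.
move=> /mapP[c cF nc]; have := @leq_bigmax_seq _ F xpredT (fun c : I * nat => c.2) c cF isT.
by rewrite -nc ltnn.
Qed.

(** The value [lin p q i] recurs at every [(i, n)], and the null family is small at all but finitely
    many of these points. *)
Lemma lin_le_xnorm x i : N (lin x.2.1 x.2.2 i) <= xnorm x.
Proof.
apply/ler_addgt0Pr => e e0.
have [F HF] := nullP x.1 e0; have [n /HF h] := fresh F i.
have -> : lin x.2.1 x.2.2 i = ev x (i, n) - x.1 (i, n) by rewrite /ev addrAC subrr add0r.
by rewrite (le_trans (ler_rnormB _ _ _))// lerD// ev_le_xnorm.
Qed.

Lemma fst_le_xnorm x : N x.2.1 <= frame_cst J * xnorm x.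
Proof. by have [] := frame_low (lin_le_xnorm x). Qed.

Lemma snd_le_xnorm x : N x.2.2 <= frame_cst J * xnorm x.
Proof. by have [] := frame_low (lin_le_xnorm x). Qed.

Lemma xnorm_ge0 x : 0 <= xnorm x.
Proof. exact: le_trans (rnorm_ge0 _ _) (lin_le_xnorm x (frame_pt J)). Qed.

Let xnormD (x y : xspace J) : S (xnorm (x + y)) <= S (xnorm x) + S (xnorm y).
Proof.
rewrite -rmorphD emb_le; apply: xnorm_leP => c.
rewrite -[x]scale1r ev_lin mul1r scale1r.
by rewrite (le_trans (ler_rnormD _ _ _))// lerD ?ev_le_xnorm.
Qed.

Lemma evZ a x c : ev (a *: x) c = a * ev x c.
Proof.
have ev0 : ev (0 : xspace J) c = 0.
  rewrite /ev /lin -[(0 : xspace J).1 c]/(0 : K) -[(0 : xspace J).2.1]/(0 : K).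
  by rewrite -[(0 : xspace J).2.2]/(0 : K) !mulr0 !addr0.
by rewrite -[a *: x]addr0 ev_lin ev0 addr0.
Qed.

Let xnormZ_le a (x : xspace J) : xnorm (a *: x) <= N (a : K^o) * xnorm x.
Proof.
apply: xnorm_leP => c; rewrite evZ rnormM.
by rewrite ler_wpM2l ?rnorm_ge0// ev_le_xnorm.
Qed.

Let xnormZ a (x : xspace J) : S (xnorm (a *: x)) = `|a| * S (xnorm x).
Proof.
rewrite (rnormE S (a : K^o)) -rmorphM; congr (S _); apply/le_anti.
rewrite xnormZ_le/=; have [->|a0] := eqVneq a 0.
  by rewrite rnorm0 mul0r xnorm_ge0.
have na : 0 < N (a : K^o) by rewrite rnorm_gt0.
rewrite -{1}[x]scale1r -(mulVf a0) -scalerA.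
rewrite (le_trans (ler_wpM2l (ltW na) (xnormZ_le _ _)))//.
by rewrite mulrA -rnormM divff// rnorm1 mul1r.
Qed.

Let xnorm_eq0 (x : xspace J) : S (xnorm x) = 0 -> x = 0.
Proof.
rewrite -(rmorph0 S) => /emb_inj x0.
have p0 : x.2.1 = 0.
  apply/eqP; rewrite -(rnorm_eq0 S); apply/eqP/le_anti.
  by rewrite rnorm_ge0 andbT (le_trans (fst_le_xnorm x))// x0 mulr0.
have q0 : x.2.2 = 0.
  apply/eqP; rewrite -(rnorm_eq0 S); apply/eqP/le_anti.
  by rewrite rnorm_ge0 andbT (le_trans (snd_le_xnorm x))// x0 mulr0.
have g0 : x.1 = 0.
  apply: null_inj => c; apply/eqP; rewrite -(rnorm_eq0 S); apply/eqP/le_anti.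
  rewrite rnorm_ge0 andbT -x0 (le_trans _ (ev_le_xnorm x c))//.
  by rewrite /ev p0 q0 /lin !mulr0 !addr0.
by case: x p0 q0 g0 {x0} => [g [p q]] /= -> -> ->.
Qed.

HB.instance Definition _ := Lmodule_isNormed.Build K (xspace J)
  xnormD xnormZ xnorm_eq0.

Lemma rnorm_xspace (x : xspace J) : N x = xnorm x.
Proof. exact: rnorm_unique. Qed.

End NullFamilies.

Arguments ev_le_xnorm {R K S I J} x c.
Arguments fst_le_xnorm {R K S I J} x.
Arguments snd_le_xnorm {R K S I J} x.
Arguments lin_le_xnorm {R K S I J} x i.
Arguments ev {R K S I J} x c.

Section FrameSpace.
Variables (R : realType) (K : supNumFieldType) (S : scalars R K) (I : choiceType).
Variable J : frame S I.
Local Notation N := (rnorm S).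
Local Notation X := (xspace J).

Lemma evB (x y : X) c : ev (x - y) c = ev x c - ev y c.
Proof. by rewrite -scaleN1r addrC ev_lin mulN1r addrC. Qed.

(** * Completeness of the function space *)

Section Completeness.
Variables (F : set_system X) (FF : ProperFilter F).
Hypothesis cauchyF : forall e : R, 0 < e -> exists x, F [set y : X | N (y - x) <= e].

Let coordinate_cvg (f : X -> K^o) (C : R) : 0 <= C ->
  (forall x y, N (f y - f x) <= C * N (y - x)) ->
  exists l, forall e : R, 0 < e -> F [set y | N (f y - l) <= e].
Proof.
move=> C0 fC; pose G : set_system K := [set A | F (f @^-1` A)].
have GG : ProperFilter G by apply: fmap_proper_filter.
have [|l Hl] := @emb_complete _ _ S G GG.
  move=> e e0; have C1 : 0 < C + 1 by lra.
  have [|x Fx] := cauchyF (e := e / (C + 1)); first by rewrite divr_gt0.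
  exists (f x); rewrite /G /=; apply: (@filterS _ F _ _ _ _ Fx) => y /= xy.
  rewrite (rnormE S (f y - f x : K^o)) emb_le (le_trans (fC _ _))//.
  move: xy; rewrite ler_pdivlMr// => xy; apply: le_trans xy.
  by rewrite mulrC ler_wpM2l ?rnorm_ge0// lerDl.
exists l => e /Hl; rewrite /G /=; apply: (@filterS _ F) => y /=.
by rewrite (rnormE S (f y - l : K^o)) emb_le.
Qed.

Let limit_le (f : X -> K^o) (l a : K) (e : R) :
  (forall d : R, 0 < d -> F [set y | N (f y - l) <= d]) ->
  F [set y | N (f y - a : K^o) <= e] -> N (l - a : K^o) <= e.
Proof.
move=> Hl Ha; apply/ler_addgt0Pr => d d0.
have [y /= [h1 h2]] := filter_ex (filterI (Hl d d0) Ha).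
have -> : l - a = (f y - a : K^o) - (f y - l : K^o) by ring.
by rewrite (le_trans (ler_rnormB _ _ _))// lerD.
Qed.

Lemma xspace_cauchy_cvg :
  exists l, forall e : R, 0 < e -> F [set y : X | N (y - l) <= e].
Proof.
set C := frame_cst J; have C0 : 0 <= C by apply: frame_cst_ge0.
have fstB (x y : X) : N ((y.2.1 : K^o) - x.2.1) <= C * N (y - x).
  by rewrite [N (y - x)]rnorm_xspace; exact: (fst_le_xnorm (y - x)).
have sndB (x y : X) : N ((y.2.2 : K^o) - x.2.2) <= C * N (y - x).
  by rewrite [N (y - x)]rnorm_xspace; exact: (snd_le_xnorm (y - x)).
have evN c (x y : X) : N (ev y c - ev x c) <= 1 * N (y - x).
  by rewrite mul1r -evB [N (y - x)]rnorm_xspace ev_le_xnorm.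
have [p Hp] := coordinate_cvg C0 fstB.
have [q Hq] := coordinate_cvg C0 sndB.
have [f Hf] := choice (fun c => coordinate_cvg (@ler01 R) (evN c)).
have approx e (x : X) : F [set y : X | N (y - x) <= e] ->
    [/\ forall c, N (f c - ev x c) <= e, N (p - x.2.1 : K^o) <= C * e &
        N (q - x.2.2 : K^o) <= C * e].
  move=> Fx; split.
  - move=> c; apply: (limit_le (Hf c)); apply: filterS Fx => y /= xy.
    by rewrite (le_trans (evN c x y))// mul1r.
  - apply: (limit_le Hp); apply: filterS Fx => y /= xy.
    by rewrite (le_trans (fstB x y))// ler_wpM2l.
  - apply: (limit_le Hq); apply: filterS Fx => y /= xy.
    by rewrite (le_trans (sndB x y))// ler_wpM2l.
have vg : vanishing S (fun c => f c - lin J p q c.1).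
  (* Off a finite set the error has four parts: the null part of [x], at most [e / 2], then [d] for
     the value and [C * d] for each coordinate of the pair, which add up to [e / 2]. *)
  move=> e e0; pose d := e / (2 * (1 + 2 * C)).
  have k0 : 0 < 2 * (1 + 2 * C) by move: C0; lra.
  have d0 : 0 < d by rewrite divr_gt0.
  have dE : d * (1 + 2 * C) = e / 2.
    by rewrite /d; field; move: C0; lra.
  have [x /approx [h1 h2 h3]] := cauchyF d0.
  have [|G HG] := nullP x.1 (e := e / 2); first by rewrite divr_gt0.
  exists G => c /HG h4.
  have -> : f c - lin J p q c.1 = x.1 c + (f c - ev x c)
      - lin J (p - x.2.1) (q - x.2.2) c.1 by rewrite /ev /lin; ring.
  rewrite (le_trans (ler_rnormB _ _ _))//.
  have := lin_le J (p - x.2.1) (q - x.2.2) c.1.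
  have := ler_rnormD S (x.1 c) (f c - ev x c).
  have := h1 c; move: dE h2 h3 h4; rewrite mulrDr mulr1 mulrCA; lra.
pose l : X := (mknull vg, (p, q)).
have lE c : ev l c = f c by rewrite /ev /= subrK.
exists l => e e0; have [|x Fx] := cauchyF (e := e / 2); first by rewrite divr_gt0.
have [h1 _ _] := approx _ _ Fx.
apply: filterS Fx => y /= xy.
rewrite -(subrK x y) -addrA (le_trans (ler_rnormD _ _ _))// [e]splitr lerD//.
rewrite -opprB rnormN rnorm_xspace; apply: xnorm_leP => c.
by rewrite evB lE.
Qed.

End Completeness.

Lemma xspace_complete (F : set_system X) : ProperFilter F -> cauchy F -> cvg F.
Proof.
move=> FF /cauchyP cF; have [|l Hl] := @xspace_cauchy_cvg F FF.
  move=> e e0; have [|x Fx] := cF (S e); first by rewrite emb_gt0.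
  exists x; apply: filterS Fx => y; rewrite -ball_normE /= => xy.
  by rewrite rnorm_distC -(emb_le S) -rnormE ltW.
apply: (cvgP l); apply/cvg_ballP => e e0.
have [d dE] := emb_onto S (ltW e0).
have d0 : 0 < d by rewrite -(emb_gt0 S) -dE.
have d2 : 0 < d / 2 by rewrite divr_gt0.
apply: filterS (Hl _ d2) => y /= yl; rewrite -ball_normE /=.
by rewrite distrC (rnormE S) dE emb_lt; lra.
Qed.

HB.instance Definition _ := Uniform_isComplete.Build (xspace J) xspace_complete.

Definition xspace_banach : completeNormedModType K := xspace J.

Definition evop (c : I * nat) : bounded_operator X K^o.
Proof.
apply: (@mkop _ _ S X K^o (fun x => ev x c) 1).
  by move=> a x y; apply: ev_lin.
by move=> x; rewrite mul1r [N x]rnorm_xspace ev_le_xnorm.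
Defined.

Lemma evopE c x : evop c x = ev x c.
Proof. by []. Qed.

Lemma rnorm_evop c : N (evop c) <= 1.
Proof.
apply: oprnorm_leM => // x; rewrite mul1r evopE.
by rewrite [N x]rnorm_xspace ev_le_xnorm.
Qed.

Lemma finite_vanishing (F : seq (I * nat)) (f : I * nat -> K^o) :
  vanishing S (fun c => if c \in F then f c else 0).
Proof. by move=> e e0; exists F => c /negbTE ->; rewrite rnorm0 ltW. Qed.

Definition fin_family F f : null_family S I := mknull (@finite_vanishing F f).

Lemma fin_familyE F f c : fin_family F f c = if c \in F then f c else 0.
Proof. by []. Qed.

(* [a = (1 + |a|)/2 * u + (1 - |a|)/2 * (- u)] with [u] of modulus one *)
Lemma unimodular_split (a : K) : N (a : K^o) <= 1 -> exists u v s,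
  [/\ N (u : K^o) = 1, N (v : K^o) = 1, 0 <= s <= 1 & a = S s * u + S (1 - s) * v].
Proof.
move=> a1; have [w [w1 wa]] := phase S a.
have w0 : w != 0 by rewrite -(rnorm_eq0 S (w : K^o)) w1 oner_eq0.
have wV : N (w^-1 : K^o) = 1.
  by have := rnormM S w w^-1; rewrite divff// rnorm1 w1 mul1r.
exists w^-1, (- w^-1), ((1 + N (a : K^o)) / 2); split => //.
- by rewrite rnormN.
- have := rnorm_ge0 S (a : K^o); move: a1; lra.
- rewrite mulrN -mulrBl -rmorphB.
  rewrite (_ : _ - _ = N (a : K^o)); last by field.
  by rewrite -wa mulrAC divff// mul1r.
Qed.

Lemma evop_splitting c : splitting S (evop c).
Proof.
split; first exact: rnorm_evop.
move=> x e x1 e0.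
have [u [v [s [u1 v1 s01 evE]]]] : exists u v s,
  [/\ N (u : K^o) = 1, N (v : K^o) = 1, 0 <= s <= 1 &
      ev x c = S s * u + S (1 - s) * v].
  apply: unimodular_split; apply: le_trans x1.
  by rewrite [N x]rnorm_xspace ev_le_xnorm.
(* Replacing the value at [c] is a finitely supported change, so the pair stays fixed, and the
   convex combination reproduces [x] exactly. *)
pose y w : X := (x.1 + fin_family [:: c] (fun _ => w - ev x c), x.2).
have yE w d : ev (y w) d = if d == c then w else ev x d.
  have -> : ev (y w) d = x.1 d + fin_family [:: c] (fun _ => w - ev x c) d
      + lin J x.2.1 x.2.2 d.1 by [].
  rewrite fin_familyE inE.
  by case: eqP => [->|_]; [rewrite /ev; ring | rewrite addr0].
have y1 w : N (w : K^o) = 1 -> N (y w) <= 1.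
  move=> w1; rewrite rnorm_xspace; apply: xnorm_leP => d; rewrite yE.
  case: eqP => _; first by rewrite w1.
  by rewrite (le_trans (ev_le_xnorm x d))// -rnorm_xspace.
exists (y u), (y v), s; split => //.
- by split; apply: y1.
- by rewrite evopE yE eqxx.
- by rewrite evopE yE eqxx.
- rewrite rnorm_xspace; apply: xnorm_leP => d.
  rewrite evB ev_lin evZ !yE.
  case: eqP => [->|_]; first by rewrite evE subrr rnorm0 ltW.
  by rewrite -mulrDl -rmorphD (addrC s) subrK rmorph1 mul1r subrr rnorm0 ltW.
Qed.

Lemma xspace_neq0 : exists x : X, x != 0.
Proof.
pose x : X := (fin_family [:: (frame_pt J, 0%N)] (fun _ => 1), (0, 0)).
exists x; rewrite -(rnorm_gt0 S) rnorm_xspace.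
apply: lt_le_trans (ev_le_xnorm x (frame_pt J, 0%N)).
have -> : ev x (frame_pt J, 0%N) =
    (if (frame_pt J, 0%N) \in [:: (frame_pt J, 0%N)] then 1 else 0)
    + lin J 0 0 (frame_pt J) by [].
by rewrite inE eqxx /lin !mulr0 !addr0 rnorm1.
Qed.

Lemma rindex_xspace : rindex S X = 1.
Proof.
apply: (@rindex1_norming _ _ S X [set evop c | c in setT]).
- exact: xspace_neq0.
- by move=> _ [c _ <-]; apply: evop_splitting.
- move=> x m H; rewrite rnorm_xspace; apply: xnorm_leP => c.
  by have := H (evop c); apply; exists c.
Qed.

End FrameSpace.

(** * Their duals *)

Section DualOfFrameSpace.
Variables (R : realType) (K : supNumFieldType) (S : scalars R K) (I : choiceType).
Variable J : frame S I.
Local Notation N := (rnorm S).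
Local Notation X := (xspace J).
Implicit Types (F : seq (I * nat)) (phi : bounded_operator X K^o).

Lemma rnorm_ev (x : X) c : N (ev x c) <= N x.
Proof. by rewrite [N x]rnorm_xspace ev_le_xnorm. Qed.

Lemma rnorm_lin (x : X) i : N (lin J x.2.1 x.2.2 i) <= N x.
Proof. by rewrite [N x]rnorm_xspace lin_le_xnorm. Qed.

Lemma rnorm_xle (x : X) M : (forall c, N (ev x c) <= M) -> N x <= M.
Proof. by rewrite [N x]rnorm_xspace; apply: xnorm_leP. Qed.

Lemma xspace_ext (x y : X) : (forall c, ev x c = ev y c) -> x = y.
Proof.
move=> xy; apply/eqP; rewrite -subr_eq0 -(rnorm_eq0 S); apply/eqP/le_anti.
rewrite rnorm_ge0 andbT; apply: rnorm_xle => c.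
by rewrite evB xy subrr rnorm0.
Qed.

(** Prescribes finitely many values freely while keeping a given pair at infinity: test vectors in
    which the null part and the pair are decoupled. *)
Definition patch F (f : I * nat -> K^o) (p q : K) : X :=
  (fin_family S F (fun c => f c - lin J p q c.1), (p, q)).

Lemma ev_patch F f p q c :
  ev (patch F f p q) c = if c \in F then f c else lin J p q c.1.
Proof.
have -> : ev (patch F f p q) c =
  (if c \in F then f c - lin J p q c.1 else 0) + lin J p q c.1 by [].
by case: ifP; rewrite ?subrK ?add0r.
Qed.

Lemma patch_le F f p q M : (forall c, c \in F -> N (f c) <= M) ->
  (forall i, N (lin J p q i) <= M) -> N (patch F f p q) <= M.
Proof.
by move=> fM lM; apply: rnorm_xle => c; rewrite ev_patch; case: ifP => // /fM.
Qed.

Lemma patch_lin F a f p q f' p' q' :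
  patch F (fun c => a * f c + f' c) (a * p + p') (a * q + q')
  = a *: patch F f p q + patch F f' p' q'.
Proof.
by apply: xspace_ext => c; rewrite ev_lin !ev_patch; case: ifP; rewrite ?lin_lin.
Qed.

(* If [x0] nearly attains the norm of [phi] on null families and is supported in
   [F], then any [x] vanishing on [F] can be added to it without increasing the
   norm; hence [phi x] is small. *)
Lemma null_tail phi e : 0 < e -> exists F, forall x : X, x.2 = (0, 0) ->
  (forall c, c \in F -> ev x c = 0) -> N (phi x : K^o) <= e * N x.
Proof.
move=> e0; pose A : set R :=
  [set N (phi x : K^o) | x in [set x : X | x.2 = (0, 0) /\ N x <= 1]].
have supA : has_sup A.
  split; first by exists (N (phi 0 : K^o)), 0; rewrite //= rnorm0.
  by exists (N phi) => _ [x [_ x1] <-]; apply: oprnorm_unit.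
have [|_ [x0 [x00 x01] <-] hx0] := @sup_adherent _ A (e / 2) _ supA.
  by rewrite divr_gt0.
have np : 0 < 2 * (1 + N phi) by have := rnorm_ge0 S phi; lra.
have [|F HF] := nullP x0.1 (e := e / (2 * (1 + N phi))); first by rewrite divr_gt0.
have lin0 i : lin J 0 0 i = 0 by rewrite /lin !mulr0 addr0.
have evx0 c : ev x0 c = x0.1 c by rewrite /ev x00 lin0 addr0.
pose y := patch F (ev x0) 0 0.
have yx0 : N (phi x0 : K^o) - e / 2 <= N (phi y : K^o).
  rewrite lerBlDr addrC -lerBlDr (le_trans (ler_rdist _ _ _))// -linearB.
  rewrite (le_trans (ler_oprnorm _ _ _))//.
  have h : N (x0 - y) <= e / (2 * (1 + N phi)).
    apply: rnorm_xle => c; rewrite evB ev_patch; case: ifPn => [_|/HF h].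
      by rewrite subrr rnorm0 ltW// divr_gt0.
    by rewrite lin0 subr0 evx0.
  rewrite (le_trans (ler_wpM2l (rnorm_ge0 S _) h))// mulrA ler_pdivrMr//.
  have := rnorm_ge0 S phi; nra.
exists F => x x2 xF.
have key (z : X) : z.2 = (0, 0) -> (forall c, c \in F -> ev z c = 0) -> N z <= 1 ->
    N (phi z : K^o) <= e.
  move=> z2 zF z1.
  have [u [u1 uE]] := phase S (phi y : K).
  have [v [v1 vE]] := phase S (phi z : K).
  pose w : X := u *: y + v *: z.
  have w2 : w.2 = (0, 0).
    rewrite /w -[(u *: y + v *: z).2]/(u *: y.2 + v *: z.2) z2 /y /=.
    by congr pair; rewrite /= -[RHS]addr0; congr (_ + _); apply: mulr0.
  have w1 : N w <= 1.
    apply: rnorm_xle => c; rewrite /w ev_lin evZ ev_patch.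
    case: ifPn => [/zF ->|_].
      by rewrite mulr0 addr0 rnormM u1 mul1r (le_trans (rnorm_ev _ _)).
    by rewrite lin0 mulr0 add0r rnormM v1 mul1r (le_trans (rnorm_ev _ _)).
  have := sup_upper_bound supA; move=> /(_ (N (phi w : K^o))) h.
  have {h} : N (phi w : K^o) <= sup A by apply: h; exists w.
  have -> : phi w = S (N (phi y : K^o) + N (phi z : K^o)).
    by rewrite rmorphD -uE -vE /w linearD !linearZ.
  rewrite rnorm_emb ger0_norm ?addr_ge0 ?rnorm_ge0//.
  move: yx0 hx0; lra.
have [->|xn0] := eqVneq x 0; first by rewrite linear0 !rnorm0 mulr0.
have nx : 0 < N x by rewrite rnorm_gt0.
have phiE : phi (S (N x)^-1 *: x) = S (N x)^-1 *: phi x by rewrite linearZ.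
have := key (S (N x)^-1 *: x).
rewrite rnorm_normalize// phiE rnormZ_emb ger0_norm ?invr_ge0 ?rnorm_ge0//.
rewrite ler_pdivrMl// mulrC; apply => //.
- rewrite -[(_ *: x).2]/(S (N x)^-1 *: x.2) x2.
  by congr pair; apply: mulr0.
- by move=> c /xF xc; rewrite evZ xc mulr0.
Qed.

(* The value at [(p, q)] of the singular part of [phi], i.e. of [phi] minus its
   absolutely summable part, as a limit along finite sets. *)
Lemma singular_exists phi (p q : K) : exists l : K, forall e : R, 0 < e ->
  exists F, forall F', {subset F <= F'} ->
    N (phi (patch F' (fun=> 0) p q) - l : K^o) <= e.
Proof.
pose G : set_system K := [set A | exists F, forall F', {subset F <= F'} ->
  A (phi (patch F' (fun=> 0) p q))].
have GG : ProperFilter G.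
  split; first by move=> [F /(_ F)]; apply.
  split.
  - by exists [::].
  - move=> A B [F1 H1] [F2 H2]; exists (F1 ++ F2) => F' FF'; split.
      by apply: H1 => c cF; apply: FF'; rewrite mem_cat cF.
    by apply: H2 => c cF; apply: FF'; rewrite mem_cat cF orbT.
  - by move=> A B AB [F H]; exists F => F' /H; apply: AB.
have [|l Hl] := @emb_complete _ _ S G GG; last first.
  exists l => e /Hl [F HF]; exists F => F' /HF /=.
  by rewrite (rnormE S (_ - l : K^o)) emb_le.
move=> e e0; set M := N (p : K^o) + N (q : K^o).
have M0 : 0 <= M by rewrite addr_ge0 ?rnorm_ge0.
(* Patches over two sets containing [F] differ by a null element that vanishes on [F] and has norm
   at most [M], so [null_tail] gives the Cauchy property. *)
have [|F HF] := @null_tail phi (e / (1 + M)); first by rewrite divr_gt0// ltr_pwDl.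
exists (phi (patch F (fun=> 0) p q)), F => F' FF' /=.
rewrite (rnormE S (_ - _ : K^o)) emb_le -linearB.
have h : N (patch F' (fun=> 0) p q - patch F (fun=> 0) p q) <= M.
  apply: rnorm_xle => c; rewrite evB !ev_patch.
  case: ifPn => cF'; case: ifPn => cF; rewrite ?subrr ?subr0 ?sub0r ?rnorm0 ?rnormN//.
    exact: lin_le.
  by rewrite (FF' _ cF) in cF'.
have nM : 0 < 1 + M by rewrite ltr_pwDl.
rewrite (le_trans (HF _ _ _))//.
- by rewrite -[(_ - _).2]/((p - p, q - q) : K * K) !subrr.
- by move=> c cF; rewrite evB !ev_patch cF (FF' _ cF) subrr.
rewrite (le_trans (ler_wpM2l _ h))//; first by rewrite divr_ge0// ltW.
by rewrite mulrAC ler_pdivrMr// ler_wpM2l ?lerDr// ltW.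
Qed.

Definition singular phi p q : K := sval (cid (singular_exists phi p q)).

Lemma singularP phi p q e : 0 < e -> exists F, forall F', {subset F <= F'} ->
  N (phi (patch F' (fun=> 0) p q) - singular phi p q : K^o) <= e.
Proof. exact: (svalP (cid (singular_exists phi p q))). Qed.

Lemma singular_unique phi p q l :
  (forall e : R, 0 < e -> exists F, forall F', {subset F <= F'} ->
     N (phi (patch F' (fun=> 0) p q) - l : K^o) <= e) ->
  singular phi p q = l.
Proof.
move=> H; apply/eqP; rewrite -subr_eq0 -(rnorm_eq0 S (_ : K^o)).
apply/eqP/le_anti; rewrite rnorm_ge0 andbT.
apply/ler_addgt0Pr => e e0; rewrite add0r.
have e2 : 0 < e / 2 by rewrite divr_gt0.
have [F1 H1] := singularP phi p q e2; have [F2 H2] := H _ e2.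
have {}H1 := H1 (F1 ++ F2); have {}H2 := H2 (F1 ++ F2).
set a := phi _ in H1 H2.
have -> : singular phi p q - l = (a - l : K^o) - (a - singular phi p q : K^o) by ring.
rewrite (le_trans (ler_rnormB _ _ _))// [e]splitr lerD//.
  by apply: H2 => c cF; rewrite mem_cat cF orbT.
by apply: H1 => c cF; rewrite mem_cat cF.
Qed.

(** Stated with three functionals and three pairs so that it yields both linearity in the pair and
    linearity in the functional. *)
Lemma singular_comb (a : K) phi phi' phi'' p q p' q' p'' q'' :
  (forall F, phi (patch F (fun=> 0) p q) =
     a * phi' (patch F (fun=> 0) p' q') + phi'' (patch F (fun=> 0) p'' q'')) ->
  singular phi p q = a * singular phi' p' q' + singular phi'' p'' q''.
Proof.
move=> E; apply: singular_unique => e e0.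
have d0 : 0 < e / (1 + N (a : K^o)) by rewrite divr_gt0// ltr_pwDl ?rnorm_ge0.
have [F1 H1] := singularP phi' p' q' (divr_gt0 d0 (ltr0n _ 2)).
have [F2 H2] := singularP phi'' p'' q'' (divr_gt0 d0 (ltr0n _ 2)).
exists (F1 ++ F2) => F' FF'; rewrite E.
have {}H1 : N (phi' (patch F' (fun=> 0) p' q') - singular phi' p' q' : K^o)
    <= e / (1 + N (a : K^o)) / 2.
  by apply: H1 => c cF; apply: FF'; rewrite mem_cat cF.
have {}H2 : N (phi'' (patch F' (fun=> 0) p'' q'') - singular phi'' p'' q'' : K^o)
    <= e / (1 + N (a : K^o)) / 2.
  by apply: H2 => c cF; apply: FF'; rewrite mem_cat cF orbT.
set s' := singular phi' _ _ in H1 *; set s'' := singular phi'' _ _ in H2 *.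
set b' := phi' _ in H1 *; set b'' := phi'' _ in H2 *.
have -> : a * b' + b'' - (a * s' + s'') = a * (b' - s') + (b'' - s'') by ring.
rewrite (le_trans (ler_rnormD S (a * (b' - s') : K^o) _))// rnormM.
set d := e / _ in d0 H1 H2.
have -> : e = d * (1 + N (a : K^o)) by rewrite /d divfK// gt_eqF// ltr_pwDl ?rnorm_ge0.
have := rnorm_ge0 S (a : K^o); nra.
Qed.

Lemma singular_le phi p q M : (forall i, N (lin J p q i) <= M) ->
  N (singular phi p q : K^o) <= N phi * M.
Proof.
move=> HM; apply/ler_addgt0Pr => e e0; have [F HF] := singularP phi p q e0.
have {}HF := HF F (fun c cF => cF).
set a := phi _ in HF; have -> : singular phi p q = (a : K^o) - (a - singular phi p q) by ring.
rewrite (le_trans (ler_rnormB _ _ _))// lerD//.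
rewrite (le_trans (ler_oprnorm _ _ _))// ler_wpM2l ?rnorm_ge0//.
apply: patch_le => // c _; rewrite rnorm0.
exact: le_trans (rnorm_ge0 _ _) (HM (frame_pt J)).
Qed.

End DualOfFrameSpace.

(** * The operator on the dual that lowers its numerical index *)

Section SingularOperator.
Variables (R : realType) (K : supNumFieldType) (S : scalars R K) (I : choiceType).
Variables (J : frame S I) (tau : K).
Local Notation N := (rnorm S).
Local Notation X := (xspace J).
Local Notation C := (frame_cst J).
Hypothesis tau1 : N (tau : K^o) <= 1.

Lemma patch0_lin F a p q p' q' :
  patch J F (fun=> 0) (a * p + p') (a * q + q')
  = a *: patch J F (fun=> 0) p q + patch J F (fun=> 0) p' q'.
Proof.
rewrite -patch_lin; congr patch.
by apply/funext => c; rewrite mulr0 addr0.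
Qed.

Lemma rnorm_fst (x : X) : N (x.2.1 : K^o) <= C * N x.
Proof. by rewrite [N x]rnorm_xspace fst_le_xnorm. Qed.

Lemma rnorm_snd (x : X) : N (x.2.2 : K^o) <= C * N x.
Proof. by rewrite [N x]rnorm_xspace snd_le_xnorm. Qed.

Lemma lin_swap_le (x : X) i : N (lin J x.2.2 (tau * x.2.1) i) <= 2 * C * N x.
Proof.
rewrite (le_trans (lin_le _ _ _ _))// rnormM.
have := rnorm_fst x; have := rnorm_snd x.
move: (rnorm_ge0 S (x.2.1 : K^o)) tau1; nra.
Qed.

Lemma swap_linear (phi : bounded_operator X K^o) :
  linear (fun x : X => singular phi x.2.2 (tau * x.2.1) : K^o).
Proof.
move=> a x y; apply: singular_comb => F.
rewrite -[(_ + _).2.2]/(a * x.2.2 + y.2.2) -[(_ + _).2.1]/(a * x.2.1 + y.2.1).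
by rewrite mulrDr mulrCA patch0_lin linearD linearZ.
Qed.

Lemma swap_bounded (phi : bounded_operator X K^o) (x : X) :
  N (singular phi x.2.2 (tau * x.2.1) : K^o) <= N phi * (2 * C) * N x.
Proof.
rewrite -mulrA; apply: singular_le => i; exact: lin_swap_le.
Qed.

Definition swap_functional (phi : bounded_operator X K^o) : bounded_operator X K^o :=
  mkop (swap_linear phi) (swap_bounded phi).

Lemma swap_functional_linear :
  linear (swap_functional : dual X -> dual X).
Proof.
move=> a phi psi; apply/val_inj/funext => x.
exact: (@singular_comb _ _ _ _ _ a (a *: phi + psi : dual X) phi psi).
Qed.

Lemma swap_functional_bounded (phi : dual X) :
  N (swap_functional phi : dual X) <= 2 * C * N phi.
Proof.
rewrite [2 * C * _]mulrC; apply: oprnorm_leM; last exact: swap_bounded.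
by rewrite mulr_ge0 ?rnorm_ge0// mulr_ge0// frame_cst_ge0.
Qed.

Definition swap_operator : bounded_operator (dual X) (dual X) :=
  mkop swap_functional_linear swap_functional_bounded.

Lemma swap_operatorE (phi : dual X) (x : X) :
  (swap_operator phi : bounded_operator X K^o) x
  = singular phi x.2.2 (tau * x.2.1).
Proof. by []. Qed.

(* On the singular part of the dual the operator acts as the transpose of
   [(p, q) |-> (q, tau p)] and on the absolutely summable part as [0]. *)
Lemma swap_perturb (z : K) (h : R) (phi : dual X) : 1 <= h ->
  (forall (p q : K) M, (forall i, N (lin J p q i) <= M) ->
     forall i, N (lin J (p + z * q) (q + z * (tau * p)) i) <= h * M) ->
  N (phi + z *: swap_operator phi) <= h * N phi.
Proof.
move=> h1 Hz; apply: oprnorm_le => x x1.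
have -> : (phi + z *: swap_operator phi : bounded_operator X K^o) x =
  (phi : bounded_operator X K^o) x + z * singular phi x.2.2 (tau * x.2.1) by [].
move: phi => phi'; pose phi : bounded_operator X K^o := phi'.
rewrite -/phi; set p := x.2.1; set q := x.2.2.
apply/ler_addgt0Pr => e e0.
have zn := rnorm_ge0 S (z : K^o); have C0 := frame_cst_ge0 J.
pose D := 1 + N (z : K^o) * (2 * C) + h.
have D0 : 0 <= D by rewrite /D; nra.
have k0 : 0 < D + N (z : K^o) + 1 by lra.
pose d := e / (D + N (z : K^o) + 1).
have d0 : 0 < d by rewrite divr_gt0.
have [F1 H1] := null_tail phi d0.
have [F2 H2] := singularP phi q (tau * p) d0.
pose F := F1 ++ F2; pose u := patch J F (fun=> 0) q (tau * p).
have {}H2 : N (phi u - singular phi q (tau * p) : K^o) <= d.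
  by apply: H2 => c cF; rewrite mem_cat cF orbT.
(* On [F], [y] has the values of [x], at most 1 <= h; elsewhere it has those of the moved pair; so
   its norm is at most [h]. The difference [w] below has zero pair and vanishes on [F], hence
   [phi w] is small and [phi y] is close to the quantity to be bounded. *)
pose y := patch J F (ev x) (p + z * q) (q + z * (tau * p)).
have linx i : N (lin J p q i) <= 1 by rewrite (le_trans (rnorm_lin x i)).
have yh : N y <= h.
  apply: patch_le => [c _|i].
    by rewrite (le_trans (rnorm_ev x c))// (le_trans x1).
  by rewrite -[h]mulr1; apply: Hz.
have u1 : N u <= 2 * C.
  have h' i : N (lin J q (tau * p) i) <= 2 * C.
    by rewrite (le_trans (lin_swap_le x i))// ler_piMr// mulr_ge0.
  by apply: patch_le => // c _; rewrite rnorm0 mulr_ge0.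
pose w := x + z *: u - y.
have wD : N w <= D.
  rewrite /D (le_trans (ler_rnormB _ _ _))// lerD// (le_trans (ler_rnormD _ _ _))//.
  by rewrite lerD// rnormZ ler_wpM2l.
have {}H1 : N (phi w : K^o) <= d * D.
  rewrite (le_trans (H1 _ _ _)) ?ler_wpM2l ?(ltW d0)//.
    rewrite -[w.2]/((p + z * q - (p + z * q), q + z * (tau * p) - (q + z * (tau * p))) : K * K).
    by rewrite !subrr.
  move=> c cF; rewrite evB [x + _]addrC ev_lin !ev_patch mem_cat cF /=.
  by rewrite mulr0 add0r subrr.
have -> : phi x + z * singular phi q (tau * p) =
    (phi y + phi w : K^o) - z *: (phi u - singular phi q (tau * p) : K^o).
  have -> : phi w = phi x + z * phi u - phi y by rewrite linearB linearD linearZ.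
  rewrite -[_ *: _]/(z * (phi u - singular phi q (tau * p))); ring.
rewrite (le_trans (ler_rnormB _ _ _))// rnormZ.
have hy : N (phi y : K^o) <= h * N phi.
  by rewrite (le_trans (ler_oprnorm _ _ _))// mulrC ler_wpM2r ?rnorm_ge0.
have := ler_rnormD S (phi y : K^o) (phi w).
have : N (z : K^o) * N (phi u - singular phi q (tau * p) : K^o) <= N (z : K^o) * d.
  by rewrite ler_wpM2l.
have : d * (D + N (z : K^o) + 1) = e by rewrite /d divfK// gt_eqF.
rewrite -/phi; move: H1 hy d0; rewrite -[N (phi' : dual X)]/(N phi); lra.
Qed.

(** Comparing first-order terms in |z| bounds the numerical radius by [c]. The norm times [m] is at
    least 1: the functional (p, q) |-> p has norm at most one, since the distinguished point reads
    [p]; it is sent to (p, q) |-> q, which is 1 at the pair (0, 1) of norm at most [m]. *)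
Lemma rindex_dual_le (c m : R) :
  (forall p q, lin J p q (frame_pt J) = p) ->
  (forall i, N (frame_snd J i : K^o) <= m) -> 0 <= c ->
  (forall z : K, 0 < N (z : K^o) -> N (z : K^o) <= 2^-1 ->
     forall p q M, (forall i, N (lin J p q i) <= M) ->
     forall i, N (lin J (p + z * q) (q + z * (tau * p)) i)
                 <= (1 + c * N (z : K^o) + 2 * N (z : K^o) ^+ 2) * M) ->
  rindex S (dual X) <= c * m.
Proof.
move=> Jpt Jm c0 Hz.
have vc : rradius S swap_operator <= c.
  apply: rradius_le => // phi Phi [phi1 Phi1 Phiphi].
  set w := N _; apply/ler_addgt0Pr => e e0.
  (* [r <= 1/2] is the range in which the hypothesis applies, and [2 r <= e] absorbs the quadratic
     term after division by [r]. *)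
  pose r := Num.min (2^-1) (e / 2).
  have r0 : 0 < r by rewrite lt_min; apply/andP; split; lra.
  have [r1 r2] : r <= 2^-1 /\ r <= e / 2 by split; rewrite ge_min lexx ?orbT.
  have [u [u1 uE]] := phase S (Phi (swap_operator phi) : K).
  pose z := S r * u.
  have zr : N (z : K^o) = r by rewrite rnormM u1 mulr1 rnorm_emb gtr0_norm.
  have := @swap_perturb z (1 + c * r + 2 * r ^+ 2) phi.
  rewrite phi1 mulr1 => H.
  have {}H : N (phi + z *: swap_operator phi) <= 1 + c * r + 2 * r ^+ 2.
    apply: H; first by nra.
    by move: (Hz z); rewrite zr; apply.
  have : N (Phi (phi + z *: swap_operator phi) : K^o) <= 1 + c * r + 2 * r ^+ 2.
    by rewrite (le_trans (ler_oprnorm _ _ _))// Phi1 mul1r.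
  have -> : Phi (phi + z *: swap_operator phi) = S (1 + r * w).
    have -> : Phi (phi + z *: swap_operator phi) =
      Phi phi + z * Phi (swap_operator phi) by rewrite linearD linearZ.
    by rewrite Phiphi rmorphD rmorph1 rmorphM -uE /z mulrA.
  rewrite rnorm_emb => /(le_trans (ler_norm _)) H'.
  have : r * w <= r * (c + 2 * r) by move: H'; rewrite expr2; lra.
  rewrite ler_pM2l//; lra.
have fst_linear : linear (fun x : X => x.2.1 : K^o) by [].
have fst_bounded (x : X) : N (x.2.1 : K^o) <= 1 * N x.
  by rewrite mul1r -(Jpt x.2.1 x.2.2) rnorm_lin.
pose fst_op : bounded_operator X K^o := mkop fst_linear fst_bounded.
have fst1 : N fst_op <= 1 by apply: oprnorm_leM => // x; apply: fst_bounded.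
pose x0 : X := patch J [::] (fun=> 0) 0 1.
have x0m : N x0 <= m.
  apply: patch_le => // i; rewrite /lin mulr0 add0r mulr1.
  exact: Jm.
have T1 : (swap_operator (fst_op : dual X) : bounded_operator X K^o) x0 = 1.
  rewrite swap_operatorE -[x0.2.2]/(1 : K) -[x0.2.1]/(0 : K) mulr0.
  apply: singular_unique => e e0; exists [::] => F' _.
  by rewrite -[fst_op _]/(1 : K) subrr rnorm0 ltW.
have h1 := ler_oprnorm S (swap_operator (fst_op : dual X) : bounded_operator X K^o) x0.
rewrite T1 rnorm1 in h1.
have h2 := ler_oprnorm S swap_operator (fst_op : dual X).
have h3 := rindex_le S swap_operator.
have i0 := rindex_ge0 S (dual X).
set n := rindex S _ in h3 i0 *; set t := N swap_operator in h2 h3.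
set b := N (swap_operator _) in h1 h2.
have t0 : 0 <= t by apply: rnorm_ge0.
have b0 : 0 <= b by apply: rnorm_ge0.
have n0 := rnorm_ge0 S x0.
have m0 : 0 <= m by apply: le_trans x0m.
have h4 : 1 <= t * m.
  apply: (le_trans h1); apply: ler_pM => //; apply: (le_trans h2).
  by rewrite ler_piMr.
apply: (@le_trans _ _ (n * (t * m))); first by rewrite ler_peMr.
by rewrite mulrA ler_wpM2r// (le_trans h3).
Qed.

End SingularOperator.

(** * The maximum norm on pairs: the dual has index one *)

Section CoordinateFrame.
Variables (R : realType) (K : supNumFieldType) (S : scalars R K) (I : choiceType).
Variables (J : frame S I).
Local Notation N := (rnorm S).
Local Notation X := (xspace J).

Lemma patch_decomp (F : seq (I * nat)) f p q (phi : bounded_operator X K^o) : uniq F ->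
  phi (patch J F f p q) =
    \sum_(c <- F) f c * phi (patch J [:: c] (fun=> 1) 0 0)
    + p * phi (patch J F (fun=> 0) 1 0) + q * phi (patch J F (fun=> 0) 0 1).
Proof.
move=> uF.
have lin0 i : lin J 0 0 i = 0 by rewrite /lin !mulr0 addr0.
have -> : patch J F f p q =
    (\sum_(c <- F) f c *: patch J [:: c] (fun=> 1) 0 0
     + p *: patch J F (fun=> 0) 1 0) + q *: patch J F (fun=> 0) 0 1.
  apply: xspace_ext => d.
  rewrite [_ + q *: _]addrC ev_lin [_ + p *: _]addrC ev_lin.
  have -> : ev (\sum_(c <- F) f c *: patch J [:: c] (fun=> 1) 0 0) d =
      \sum_(c <- F) (if d == c then f c else 0).
    rewrite -evopE linear_sum /=; apply: eq_bigr => c _.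
    rewrite evZ ev_patch inE lin0; case: eqP => _; first by rewrite mulr1.
    by rewrite mulr0.
  rewrite !ev_patch -big_mkcond; case: ifPn => dF.
    rewrite !mulr0 !add0r -big_filter.
    rewrite (_ : [seq _ <- F | _] = [:: d]) ?big_seq1//.
    rewrite (eq_filter (a2 := pred1 d)) ?filter_pred1_uniq// => c.
    by rewrite [RHS]eq_sym.
  rewrite big_seq_cond big_pred0; last first.
    by move=> c; apply/negbTE/negP => /andP[cF /eqP dc]; rewrite dc cF in dF.
  by rewrite /lin; ring.
rewrite !linearD linear_sum !linearZ /=; congr (_ + _ + _).
by apply: eq_bigr => c _; rewrite linearZ.
Qed.

Hypothesis coordinate : forall i,
  (forall p q, lin J p q i = p) \/ (forall p q, lin J p q i = q).
Hypothesis fst_exists : exists i, forall p q, lin J p q i = p.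
Hypothesis snd_exists : exists i, forall p q, lin J p q i = q.

Let lin_max p q M i : N (p : K^o) <= M -> N (q : K^o) <= M -> N (lin J p q i) <= M.
Proof. by case: (coordinate i) => ->. Qed.

Let fst_linear : linear (fun x : X => x.2.1 : K^o). Proof. by []. Qed.
Let snd_linear : linear (fun x : X => x.2.2 : K^o). Proof. by []. Qed.

Let fst_bounded (x : X) : N (x.2.1 : K^o) <= 1 * N x.
Proof. by have [i Hi] := fst_exists; rewrite mul1r -(Hi x.2.1 x.2.2) rnorm_lin. Qed.

Let snd_bounded (x : X) : N (x.2.2 : K^o) <= 1 * N x.
Proof. by have [i Hi] := snd_exists; rewrite mul1r -(Hi x.2.1 x.2.2) rnorm_lin. Qed.

Definition fst_op : bounded_operator X K^o := mkop fst_linear fst_bounded.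
Definition snd_op : bounded_operator X K^o := mkop snd_linear snd_bounded.

(** For the maximum norm the two coordinates of the pair move independently inside the unit ball.
    Since the values of [x] on [F] are kept, the only error is the null part of [x] off [F]. *)
Lemma patch_approx (x : X) e : 0 < e -> exists F, forall p q u v p' q' s,
  N x <= 1 -> N (p : K^o) <= 1 -> N (q : K^o) <= 1 ->
  N (p' : K^o) <= 1 -> N (q' : K^o) <= 1 -> (u, v) = x.2 ->
  u = S s * p + S (1 - s) * p' -> v = S s * q + S (1 - s) * q' ->
  [/\ N (patch J F (ev x) p q) <= 1, N (patch J F (ev x) p' q') <= 1 &
   N (x - (S s *: patch J F (ev x) p q + S (1 - s) *: patch J F (ev x) p' q')) <= e].
Proof.
move=> e0; have [F HF] := nullP x.1 e0.
exists F => p q u v p' q' s x1 p1 q1 p'1 q'1 uv uE vE.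
have evx1 c : N (ev x c) <= 1 by rewrite (le_trans (rnorm_ev x c)).
split.
- by apply: patch_le => [c _//|i]; apply: lin_max.
- by apply: patch_le => [c _//|i]; apply: lin_max.
apply: rnorm_xle => c; rewrite evB ev_lin evZ !ev_patch; case: ifPn => [_|/HF h].
  by rewrite -mulrDl -rmorphD (addrC s) subrK rmorph1 mul1r subrr rnorm0 ltW.
have -> : ev x c = x.1 c + lin J u v c.1 by rewrite /ev -uv.
have -> : lin J u v c.1 = S s * lin J p q c.1 + S (1 - s) * lin J p' q' c.1.
  by rewrite uE vE /lin; ring.
by rewrite addrK.
Qed.

Lemma fst_op_splitting : splitting S fst_op.
Proof.
split; first by apply: oprnorm_leM => // x; apply: fst_bounded.
move=> x e x1 e0; have [F HF] := patch_approx x e0.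
have [|u [v [s [u1 v1 s01 pE]]]] := @unimodular_split _ _ S x.2.1.
  by rewrite (le_trans (fst_bounded x))// mul1r.
have q1 : N (x.2.2 : K^o) <= 1 by rewrite (le_trans (snd_bounded x))// mul1r.
have [||||h1 h2 h3] := HF u x.2.2 x.2.1 x.2.2 v x.2.2 s x1 _ q1 _ q1 _ pE _.
- by rewrite u1.
- by rewrite v1.
- by case: (x.2).
- by rewrite -mulrDl -rmorphD (addrC s) subrK rmorph1 mul1r.
by exists (patch J F (ev x) u x.2.2), (patch J F (ev x) v x.2.2), s.
Qed.

Lemma snd_op_splitting : splitting S snd_op.
Proof.
split; first by apply: oprnorm_leM => // x; apply: snd_bounded.
move=> x e x1 e0; have [F HF] := patch_approx x e0.
have [|u [v [s [u1 v1 s01 qE]]]] := @unimodular_split _ _ S x.2.2.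
  by rewrite (le_trans (snd_bounded x))// mul1r.
have p1 : N (x.2.1 : K^o) <= 1 by rewrite (le_trans (fst_bounded x))// mul1r.
have [||||h1 h2 h3] := HF x.2.1 u x.2.1 x.2.2 x.2.1 v s x1 p1 _ p1 _ _ _ qE.
- by rewrite u1.
- by rewrite v1.
- by case: (x.2).
- by rewrite -mulrDl -rmorphD (addrC s) subrK rmorph1 mul1r.
by exists (patch J F (ev x) x.2.1 u), (patch J F (ev x) x.2.1 v), s.
Qed.

Definition coordinate_functionals : set (bounded_operator X K^o) :=
  [set d | (exists c, d = evop J c) \/ d = fst_op \/ d = snd_op].

(** This dual behaves as an l1 space: each functional is nearly a finite combination [psi] of
    coordinate functionals whose coefficients have absolute sum at most its norm, so a bound on the
    generators passes to [T]. *)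
Lemma coordinate_functionals_generate
    (T : bounded_operator (dual X) (dual X)) m : 0 <= m ->
  (forall d, coordinate_functionals d -> N (T d) <= m) -> N T <= m.
Proof.
move=> m0 Tm; apply: oprnorm_leM => // phi'.
pose phi : bounded_operator X K^o := phi'.
rewrite -[phi']/(phi : dual X).
apply/ler_addgt0Pr => e e0; have t0 := rnorm_ge0 S T.
pose d := e / (2 * (1 + N T)).
have k0 : 0 < 2 * (1 + N T) by lra.
have d0 : 0 < d by rewrite divr_gt0.
have [F0 HF0] := null_tail phi d0; pose F := undup F0.
have uF : uniq F := undup_uniq F0.
have {HF0} HF (x : X) : x.2 = (0, 0) -> (forall c, c \in F -> ev x c = 0) ->
    N (phi x : K^o) <= d * N x.
  by move=> x2 xF; apply: HF0 => // c cF; apply: xF; rewrite mem_undup.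
pose al := phi (patch J F (fun=> 0) 1 0); pose be := phi (patch J F (fun=> 0) 0 1).
pose co c := phi (patch J [:: c] (fun=> 1) 0 0).
pose psi : dual X := \sum_(c <- F) co c *: (evop J c : dual X)
  + (al *: (fst_op : dual X) + be *: (snd_op : dual X)).
have psiE (x : X) : (psi : bounded_operator X K^o) x =
    phi (patch J F (ev x) x.2.1 x.2.2).
  rewrite (patch_decomp _ _ _ _ uF) -/al -/be.
  rewrite -[LHS]/(bidual_eval S x psi) /psi !linearD linear_sum !linearZ /=.
  rewrite -addrA; congr (_ + _); last first.
    congr (_ + _); first exact: mulrC.
    exact: mulrC.
  by apply: eq_bigr => c _; exact: mulrC.
have close : N ((phi : dual X) - psi) <= d * 2.
  apply: oprnorm_leM; first by rewrite mulr_ge0// ltW.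
  move=> x; rewrite -[X in N X]/(phi x - (psi : bounded_operator X K^o) x).
  rewrite psiE -linearB -mulrA (le_trans (HF _ _ _))//.
  - rewrite -[(_ - _).2]/((x.2.1 - x.2.1, x.2.2 - x.2.2) : K * K).
    by rewrite !subrr.
  - by move=> c cF; rewrite evB ev_patch cF subrr.
  rewrite ler_wpM2l ?(ltW d0)// (le_trans (ler_rnormB _ _ _))//.
  rewrite mulr_natl mulr2n lerD//; apply: patch_le => [c _|i].
    exact: rnorm_ev.
  exact: rnorm_lin.
pose ph (a : K) : K := sval (cid (phase S a)).
have ph1 a : N (ph a : K^o) = 1 by rewrite /ph; case: cid => ? [].
have phE a : ph a * a = S (N (a : K^o)) by rewrite /ph; case: cid => ? [].
(* Test [phi] on the function whose values and pair are the phases of the coefficients; by the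
   maximum norm it lies in the unit ball. *)
have total : \sum_(c <- F) N (co c : K^o) + N (al : K^o) + N (be : K^o) <= N phi.
  have := @oprnorm_unit _ _ S _ _ phi (patch J F (fun c => ph (co c)) (ph al) (ph be)).
  rewrite (patch_decomp _ _ _ _ uF) -/al -/be !phE.
  under eq_bigr do rewrite -/(co _) phE.
  rewrite -rmorph_sum -!rmorphD rnorm_emb => /(_ _)/(le_trans (ler_norm _)); apply.
  apply: patch_le => [c _|i]; first by rewrite ph1.
  by apply: lin_max; rewrite ph1.
have Tpsi : N (T psi) <= m * N phi.
  apply: le_trans (ler_wpM2l m0 total); rewrite /psi !linearD linear_sum !linearZ.
  rewrite -addrA mulrDr (le_trans (ler_rnormD _ _ _))// lerD//.
    rewrite (le_trans (rnorm_sum _ _ _))// mulr_sumr; apply: ler_sum => c _.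
    rewrite linearZ rnormZ mulrC ler_wpM2r ?rnorm_ge0//; apply: Tm.
    by left; exists c.
  rewrite (le_trans (ler_rnormD _ _ _))// mulrDr !rnormZ lerD//.
    by rewrite mulrC ler_wpM2r ?rnorm_ge0//; apply: Tm; right; left.
  by rewrite mulrC ler_wpM2r ?rnorm_ge0//; apply: Tm; right; right.
have -> : T (phi : dual X) = T psi + T ((phi : dual X) - psi).
  by rewrite -linearD addrC subrK.
rewrite (le_trans (ler_rnormD _ _ _))// lerD// (le_trans (ler_oprnorm _ _ _))//.
rewrite (le_trans (ler_wpM2l t0 close))// /d.
have -> : N T * (e / (2 * (1 + N T)) * 2) = e * (N T / (1 + N T)).
  by field; lra.
rewrite ler_piMr ?(ltW e0)// ler_pdivrMr; lra.
Qed.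

Lemma rindex_dual_coordinate : rindex S (dual X) = 1.
Proof.
apply: (@rindex1_dual_generating _ _ S X coordinate_functionals).
- have [i Hi] := fst_exists; exists (fst_op : dual X); apply/eqP => f0.
  have : fst_op (patch J [::] (fun=> 0) 1 0) = 1 by [].
  rewrite -[fst_op]/(fst_op : dual X) f0 => /esym/eqP.
  by rewrite oner_eq0.
- move=> d [[c ->]|[->|->]].
  + exact: evop_splitting.
  + exact: fst_op_splitting.
  + exact: snd_op_splitting.
- exact: coordinate_functionals_generate.
Qed.

End CoordinateFrame.

(** * A segment of norms on pairs and continuity of the dual index *)

Section PathOfFrames.
Variables (R : realType) (K : supNumFieldType) (S : scalars R K) (I : choiceType).
Variables (a b : I -> K) (i0 i1 : I) (a1 b1 : R).
Local Notation N := (rnorm S).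
Hypothesis a_le1 : forall i, N (a i : K^o) <= 1.
Hypothesis b_le1 : forall i, N (b i : K^o) <= 1.
Hypothesis i01 : i1 != i0.
Hypotheses (ai0 : a i0 = 1) (bi0 : b i0 = 0).
Hypotheses (ai1 : a i1 = S a1) (bi1 : b i1 = S b1).
Hypotheses (a1_ge0 : 0 <= a1) (b1_gt0 : 0 < b1).

(** Extends the path to all real parameters, so that continuity can be stated on the whole line. *)
Definition clamp (t : R) : R := Num.max 0 (Num.min t 1).

Lemma clamp01 t : 0 <= clamp t <= 1.
Proof. by rewrite /clamp le_max lexx/= ge_max ler01/= ge_min lexx orbT. Qed.

Lemma clamp_id t : 0 <= t <= 1 -> clamp t = t.
Proof. by move=> /andP[t0 t1]; rewrite /clamp (min_idPl t1) (max_idPr t0). Qed.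

Lemma clamp_lipschitz s t : `|clamp s - clamp t| <= `|s - t|.
Proof.
have clampE x : [\/ x <= 0 /\ clamp x = 0, [/\ 0 <= x, x <= 1 & clamp x = x]
    | 1 <= x /\ clamp x = 1].
  rewrite /clamp; case: (leP x 1) => x1.
    by case: (leP 0 x) => x0; [apply: Or32 | apply: Or31; split => //; exact: ltW].
  by apply: Or33; rewrite (max_idPr _) ?ler01//; split => //; exact: ltW.
rewrite ler_norml; case: (ger0P (s - t)) => st;
  case: (clampE s) => [[s0 ->]|[s0 s1 ->]|[s1 ->]];
  case: (clampE t) => [[t0 ->]|[t0 t1 ->]|[t1 ->]]; apply/andP; split; lra.
Qed.

(** The weights (1, 0) at [i0] and (0, 1) elsewhere, which give the maximum norm, are moved linearly
    to (a_i, b_i). *)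
Definition path_fst t i : K := S (1 - clamp t) * (i == i0)%:R + S (clamp t) * a i.
Definition path_snd t i : K := S (1 - clamp t) * (i != i0)%:R + S (clamp t) * b i.

Let conv_le1 t (d : bool) (x : K) : N (x : K^o) <= 1 ->
  N (S (1 - clamp t) * d%:R + S (clamp t) * x : K^o) <= 1.
Proof.
move=> x1; have /andP[t0 t1] := clamp01 t.
rewrite (le_trans (ler_rnormD S (_ : K^o) _))// !rnormM !rnorm_emb.
rewrite !ger0_norm ?subr_ge0//.
have : N (d%:R : K^o) <= 1 by case: d; rewrite ?rnorm1 ?rnorm0.
have := rnorm_ge0 S (d%:R : K^o); nra.
Qed.

(** At [i0] the weight is (1, 0) for all [t], which controls [p]. At [i1] the second weight runs
    from 1 to [b1] and so stays at least [b1], whence b1 |q| <= 2 M. The constant does not depend on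
    [t]. *)
Let path_low t (p q : K) M :
  (forall i, N (path_fst t i * p + path_snd t i * q : K^o) <= M) ->
  N (p : K^o) <= (1 + 2 / b1) * M /\ N (q : K^o) <= (1 + 2 / b1) * M.
Proof.
move=> H; have /andP[t0 t1] := clamp01 t.
have k : 0 < b1^-1 by rewrite invr_gt0.
have pM : N (p : K^o) <= M.
  have := H i0; rewrite /path_fst /path_snd eqxx ai0 bi0 !mulr1 !mulr0 addr0.
  by rewrite -rmorphD subrK rmorph1 mul1r mul0r addr0.
have M0 : 0 <= M by apply: le_trans pM; apply: rnorm_ge0.
have b11 : b1 <= 1 by have := b_le1 i1; rewrite bi1 rnorm_emb gtr0_norm.
have a11 : a1 <= 1 by have := a_le1 i1; rewrite ai1 rnorm_emb ger0_norm.
have qM : b1 * N (q : K^o) <= 2 * M.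
  have := H i1; rewrite /path_fst /path_snd (negbTE i01) ai1 bi1 !mulr1 mulr0 add0r.
  rewrite -!rmorphM -rmorphD; set s := clamp t * a1; set r := 1 - _ + _.
  have s0 : 0 <= s by rewrite mulr_ge0.
  have s1 : s <= 1 by rewrite mulr_ile1.
  have rb : b1 <= r by rewrite /r; nra.
  have r0 : 0 <= r by rewrite (le_trans _ rb)// ltW.
  move=> h; have := ler_rnormB S (S s * p + S r * q : K^o) (S s * p : K^o).
  rewrite addrAC subrr add0r !rnormM !rnorm_emb (ger0_norm s0) (ger0_norm r0).
  have := rnorm_ge0 S (q : K^o); have := rnorm_ge0 S (p : K^o); nra.
split; first by rewrite (le_trans pM)// mulrDl mul1r lerDl mulr_ge0// mulr_ge0// ltW.
rewrite mulrDl mul1r -[X in X <= _]add0r lerD//.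
by rewrite mulrAC ler_pdivlMr// mulrC.
Qed.

Let path_cst_ge0 : 0 <= 1 + 2 / b1.
Proof. by rewrite addr_ge0// divr_ge0// ltW. Qed.

Definition path_frame (t : R) : frame S I :=
  @Frame _ _ S I (path_fst t) (path_snd t) (1 + 2 / b1) i0
    (fun i => conv_le1 t (i == i0) (a_le1 i))
    (fun i => conv_le1 t (i != i0) (b_le1 i))
    path_cst_ge0 (@path_low t).

Lemma path_lin_pt t p q : lin (path_frame t) p q i0 = p.
Proof.
rewrite /lin /= /path_fst /path_snd eqxx ai0 bi0 /= !mulr1 !mulr0 addr0.
by rewrite -rmorphD subrK rmorph1 mul1r mul0r addr0.
Qed.

Lemma path_lin0 p q i :
  lin (path_frame 0) p q i = (if i == i0 then p else q).
Proof.
have c0 : clamp 0 = 0 by apply: clamp_id; rewrite lexx ler01.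
rewrite /lin /= /path_fst /path_snd c0 subr0 rmorph0 rmorph1 !mul0r !addr0 !mul1r.
by case: eqP => _ /=; rewrite mul1r mul0r ?addr0 ?add0r.
Qed.

Lemma path_fst1 i : frame_fst (path_frame 1) i = a i.
Proof.
have c1 : clamp 1 = 1 by apply: clamp_id; rewrite lexx ler01.
by rewrite /= /path_fst c1 subrr rmorph0 rmorph1 mul0r add0r mul1r.
Qed.

Lemma path_snd1 i : frame_snd (path_frame 1) i = b i.
Proof.
have c1 : clamp 1 = 1 by apply: clamp_id; rewrite lexx ler01.
by rewrite /= /path_snd c1 subrr rmorph0 rmorph1 mul0r add0r mul1r.
Qed.

Lemma rindex_dual_path0 : rindex S (dual (xspace (path_frame 0))) = 1.
Proof.
apply: rindex_dual_coordinate.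
- move=> i; have [->|ii0] := eqVneq i i0.
    by left=> p q; rewrite path_lin0 eqxx.
  by right=> p q; rewrite path_lin0 (negbTE ii0).
- by exists i0 => p q; rewrite path_lin0 eqxx.
- by exists i1 => p q; rewrite path_lin0 (negbTE i01).
Qed.

(** The identity of the common carrier; only the norm, selected by the argument of [xspace],
    changes. *)
Definition path_move s t (x : xspace (path_frame s)) : xspace (path_frame t) :=
  (x.1, x.2).

(** Two coordinates, each at most [1 + 2 / b1] times the norm, with weights that move by at most
    twice the change of the parameter. *)
Let mu := 4 * (1 + 2 / b1).

Lemma path_move_le s t (x : xspace (path_frame s)) :
  N (path_move t x) <= (1 + mu * `|clamp t - clamp s|) * N x.
Proof.
set d := `|_|; apply: rnorm_xle => c.
have -> : ev (path_move t x) c = ev x c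
  + (S (clamp t - clamp s) * (a c.1 - (c.1 == i0)%:R) * x.2.1
   + S (clamp t - clamp s) * (b c.1 - (c.1 != i0)%:R) * x.2.2).
  rewrite /ev /lin /= /path_fst /path_snd !rmorphB !rmorph1; ring.
rewrite (le_trans (ler_rnormD _ _ _))// [X in _ <= X]mulrDl mul1r.
rewrite lerD ?rnorm_ev//.
have pN := rnorm_fst x; have qN := rnorm_snd x; rewrite /= in pN qN.
have d0 : 0 <= d by apply: normr_ge0.
have two (e : bool) (y : K) : N (y : K^o) <= 1 -> N (y - e%:R : K^o) <= 2.
  move=> y1; rewrite (le_trans (ler_rnormB S (y : K^o) _))//.
  by case: e; rewrite ?rnorm1 ?rnorm0; move: y1; lra.
rewrite (le_trans (ler_rnormD S (_ : K^o) _))// !rnormM !rnorm_emb -/d.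
have h1 : N (a c.1 - (c.1 == i0)%:R : K^o) * N (x.2.1 : K^o) <= 2 * ((1 + 2 / b1) * N x).
  by rewrite ler_pM ?rnorm_ge0// two.
have h2 : N (b c.1 - (c.1 != i0)%:R : K^o) * N (x.2.2 : K^o) <= 2 * ((1 + 2 / b1) * N x).
  by rewrite ler_pM ?rnorm_ge0// two.
have := ler_wpM2l d0 h1; have := ler_wpM2l d0 h2; rewrite /mu; lra.
Qed.

Definition dual_move s t (f : dual (xspace (path_frame s))) :
  dual (xspace (path_frame t)).
Proof.
apply: (@mkop _ _ S (xspace (path_frame t)) K^o
  (fun x => (f : bounded_operator _ K^o) (path_move s x))
  (N f * (1 + mu * `|clamp s - clamp t|))).
  move=> c x y.
  have -> : path_move s (c *: x + y) = c *: path_move s x + path_move s y by [].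
  by rewrite linearP.
move=> x; rewrite (le_trans (ler_oprnorm _ _ _))// -mulrA ler_wpM2l ?rnorm_ge0//.
exact: path_move_le.
Defined.

Lemma dual_move_linear s t : linear (@dual_move s t).
Proof. by move=> c f g; apply/val_inj. Qed.

Lemma dual_move_le s t f :
  N (@dual_move s t f) <= (1 + mu * `|clamp s - clamp t|) * N f.
Proof.
have mu0 : 0 <= mu by rewrite /mu mulr_ge0.
rewrite mulrC; apply: oprnorm_leM.
  by rewrite mulr_ge0 ?rnorm_ge0// addr_ge0// mulr_ge0.
move=> x; rewrite -mulrA.
rewrite -[X in N X]/((f : bounded_operator _ K^o) (path_move s x)).
rewrite (le_trans (ler_oprnorm _ _ _))// ler_wpM2l ?rnorm_ge0//.
exact: path_move_le.
Qed.

Definition dual_move_op s t := mkop (@dual_move_linear s t) (@dual_move_le s t).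

Lemma dual_path_neq0 t : exists f : dual (xspace (path_frame t)), f != 0.
Proof.
apply: (rindex_gt0_dual (S := S)); rewrite rindex_xspace.
exact: ltr01.
Qed.

Lemma rindex_dual_path_continuous h : 0 < h -> h <= 2^-1 ->
  exists2 d, 0 < d & forall s t, `|t - s| <= d ->
    rindex S (dual (xspace (path_frame t)))
      <= rindex S (dual (xspace (path_frame s))) + 10 * h.
Proof.
move=> h0 h1.
have mu0 : 0 < mu.
  by rewrite /mu mulr_gt0// (lt_le_trans ltr01)// lerDl divr_ge0// ltW.
have m0 : 0 < 3 * mu by rewrite mulr_gt0.
have d0 : 0 < h ^+ 2 / (3 * mu) by rewrite divr_gt0// exprn_gt0.
(* The 3 leaves room for the product of the two distortions: (1 + h^2 / 3)^2 <= 1 + h^2. *)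
exists (h ^+ 2 / (3 * mu)) => // s t st.
set k := 1 + mu * `|clamp s - clamp t|.
have k0 : 0 <= k by rewrite /k addr_ge0// mulr_ge0// ltW.
have kh : mu * `|clamp s - clamp t| <= h ^+ 2 / 3.
  have cst : `|clamp s - clamp t| <= h ^+ 2 / (3 * mu).
    by rewrite (le_trans (clamp_lipschitz s t))// distrC.
  rewrite (le_trans (ler_wpM2l (ltW mu0) cst))//.
  by rewrite (_ : mu * _ = h ^+ 2 / 3)//; field; rewrite gt_eqF.
apply: (@rindex_perturb _ _ S _ _ (dual_move_op s t) (dual_move_op t s) k k).
- exact: dual_path_neq0.
- by move=> f; apply/val_inj/funext => -[g pq].
- by move=> f; apply/val_inj/funext => -[g pq].
- exact: k0.
- exact: k0.
- by move=> f; apply: dual_move_le.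
- by move=> f; rewrite /k distrC; apply: dual_move_le.
- exact: h0.
- exact: h1.
rewrite /k; move: kh (normr_ge0 (clamp s - clamp t)); set w := mu * _ => wh _.
have w0 : 0 <= w by rewrite /w mulr_ge0// ltW.
have : h ^+ 2 <= 1 by nra.
nra.
Qed.

End PathOfFrames.

(** * Hahn-Banach theorem and completeness of the scalars *)

Section HahnBanach.
Variables (R : realType) (V : zmodType) (sc : R -> V -> V).
Hypothesis scDr : forall t x y, sc t (x + y) = sc t x + sc t y.
Hypothesis scDl : forall t u x, sc (t + u) x = sc t x + sc u x.
Hypothesis scA : forall t u x, sc t (sc u x) = sc (t * u) x.
Hypothesis sc1 : forall x, sc 1 x = x.

Let sc0 x : sc 0 x = 0.
Proof. by apply: (addrI (sc 0 x)); rewrite -scDl !addr0. Qed.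

Definition sublinear (p : V -> R) :=
  (forall x y, p (x + y) <= p x + p y) /\
  (forall t x, 0 <= t -> p (sc t x) = t * p x).

Lemma sublinear0 p : sublinear p -> p 0 = 0.
Proof. by move=> [_ /(_ 0 0 (lexx _))]; rewrite mul0r sc0. Qed.

Lemma sublinear_intro (p : V -> R) : (forall x y, p (x + y) <= p x + p y) ->
  (forall t x, 0 < t -> p (sc t x) <= t * p x) -> p 0 = 0 -> sublinear p.
Proof.
move=> pD pZ p0; split=> // t x; rewrite le_eqVlt => /orP[/eqP <-|t0].
  by rewrite sc0 p0 mul0r.
apply/le_anti; rewrite pZ//=.
have := pZ t^-1 (sc t x); rewrite invr_gt0 => /(_ t0).
by rewrite scA mulVf ?gt_eqF// sc1 ler_pdivlMl.
Qed.

Lemma sublinear_opp p x : sublinear p -> - p (- x) <= p x.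
Proof.
move=> sp; have := sp.1 x (- x); rewrite subrr sublinear0//; lra.
Qed.

(** A minorant of [p] that remains sublinear but is at most [- p y] at [- y], which forces linear
    behaviour along [y]. *)
Definition directional (p : V -> R) y x : R :=
  inf [set p (x + sc t y) - t * p y | t in [set t | 0 <= t]].

Section Directional.
Variables (p : V -> R) (y : V).
Hypothesis sp : sublinear p.

Let A x : set R := [set p (x + sc t y) - t * p y | t in [set t | 0 <= t]].

Let A0 x : A x !=set0.
Proof. by exists (p (x + sc 0 y) - 0 * p y); exists 0 => /=. Qed.

Let Alow x : lbound (A x) (- p (- x)).
Proof.
move=> _ [t /= t0 <-]; have := sp.1 (x + sc t y) (- x).
by rewrite addrAC subrr add0r sp.2//; lra.
Qed.

Let Ainf x : has_inf (A x).
Proof. by split=> //; exists (- p (- x)). Qed.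

Lemma directional_le x t : 0 <= t -> directional p y x <= p (x + sc t y) - t * p y.
Proof. by move=> t0; apply: ge_inf; [case: (Ainf x) | exists t]. Qed.

Lemma directional_le_self x : directional p y x <= p x.
Proof. by have := directional_le x (lexx 0); rewrite sc0 addr0 mul0r subr0. Qed.

Lemma directional_sublinear : sublinear (directional p y).
Proof.
apply: sublinear_intro.
- move=> x x'; rewrite -lerBlDr; apply: (lb_le_inf (A0 x)) => _ [t /= t0 <-].
  rewrite lerBlDl -lerBlDr; apply: (lb_le_inf (A0 x')) => _ [u /= u0 <-].
  have := directional_le (x + x') (addr_ge0 t0 u0).
  have := sp.1 (x + sc t y) (x' + sc u y).
  by rewrite addrACA -scDl; lra.
- move=> t x t0; rewrite -ler_pdivrMl//; apply: (lb_le_inf (A0 x)) => _ [u /= u0 <-].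
  rewrite ler_pdivrMl//.
  have := directional_le (sc t x) (mulr_ge0 (ltW t0) u0).
  by rewrite -scA -scDr (sp.2 _ _ (ltW t0)) mulrBr mulrA.
- apply/le_anti/andP; split; first by rewrite -(sublinear0 sp) directional_le_self.
  apply: (lb_le_inf (A0 0)) => _ [u /= u0 <-].
  by rewrite add0r sp.2// subrr.
Qed.

End Directional.

(* A minimal sublinear functional is additive: it coincides with each of its
   directional modifications, none of which exceeds it. *)
Lemma minimal_sublinear (p0 : V -> R) : sublinear p0 -> exists p, [/\ sublinear p,
  (forall x, p x <= p0 x) & forall x y, p (x + y) = p x + p y].
Proof.
move=> sp0.
pose P : {pred V -> R} := fun p => `[< sublinear p /\ forall x, p x <= p0 x >].
pose T := {p : V -> R | P p}.
(* The order is reversed, so that a maximal element in Zorn's lemma is a minimal functional. *)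
pose r : rel T := fun p q => `[< forall x, sval q x <= sval p x >].
have TP (p : T) : sublinear (sval p) /\ forall x, sval p x <= p0 x.
  by case: p => p /= /asboolP.
have P0 : P p0 by apply/asboolP.
have [||||[p Pp] pmin] := @Zorn T r.
- by move=> p; apply/asboolP.
- by move=> a b c /asboolP ab /asboolP bc; apply/asboolP => x; apply: le_trans (ab x).
- move=> a b /asboolP ab /asboolP ba; apply/val_inj/funext => x.
  by apply/le_anti; rewrite ba ab.
(* A chain is bounded by its pointwise infimum, finite because [- p0 (- x)] lies below all members
   at [x]; [p0] serves for the empty chain. *)
- move=> A chain; have [[a0 Aa0]|A0] := pselect (exists a, A a); last first.
    by exists (exist (fun p => is_true (P p)) _ P0) => s As; exfalso; apply: A0; exists s.
  pose B x : set R := [set sval (a : T) x | a in A].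
  have B0 x : B x !=set0 by exists (sval a0 x), a0.
  have Binf x : has_inf (B x).
    split=> //; exists (- p0 (- x)) => _ [a Aa <-].
    have [sa a_p0] := TP a; apply: le_trans (sublinear_opp x sa).
    by rewrite lerN2.
  have Ble x a : A a -> inf (B x) <= sval a x.
    by move=> Aa; apply: ge_inf; [case: (Binf x) | exists a].
  have Pq : P (fun x => inf (B x)).
    apply/asboolP; split; last first.
      by move=> x; apply: (le_trans (Ble x a0 Aa0)); apply: (TP a0).2.
    apply: sublinear_intro.
    - move=> x y; rewrite -lerBlDr; apply: lb_le_inf => // _ [a Aa <-].
      rewrite lerBlDl -lerBlDr; apply: lb_le_inf => // _ [b Ab <-].
      rewrite lerBlDr; have [/asboolP ab|/asboolP ba] := chain a b Aa Ab.
        apply: (le_trans (Ble _ b Ab)); have := (TP b).1.1 x y.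
        by have := ab x; lra.
      apply: (le_trans (Ble _ a Aa)); have := (TP a).1.1 x y.
      by have := ba y; lra.
    - move=> t x t0; rewrite -ler_pdivrMl//; apply: lb_le_inf => // _ [a Aa <-].
      rewrite ler_pdivrMl// (le_trans (Ble _ a Aa))//.
      by rewrite ((TP a).1.2 _ _ (ltW t0)).
    - apply/le_anti/andP; split.
        by rewrite (le_trans (Ble 0 a0 Aa0))// (sublinear0 (TP a0).1).
      by apply: lb_le_inf => // _ [a Aa <-]; rewrite (sublinear0 (TP a).1).
  exists (exist (fun p => is_true (P p)) _ Pq) => s As; apply/asboolP => x /=; exact: Ble.
have /asboolP[sp pp0] := Pp.
exists p; split => // x y.
have Pd : P (directional p y).
  apply/asboolP; split; first exact: directional_sublinear.
  by move=> z; apply: le_trans (pp0 z); apply: directional_le_self.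
pose d : T := exist (fun p => is_true (P p)) _ Pd.
have rd : r (exist (fun p => is_true (P p)) _ Pp) d.
  by apply/asboolP => z /=; apply: directional_le_self.
have E : directional p y = p := congr1 sval (pmin _ rd).
apply/le_anti; rewrite sp.1 /=.
have := directional_le y sp x ler01; rewrite E sc1 mul1r; lra.
Qed.

(** The action [sc] is an argument so that a complex space can be taken with its real multiples. The
    minimal functional is chosen below the directional modification of the norm at [y], whose value
    at [- y] forces [u y] up to the norm. *)
Lemma real_hahn_banach (nrm : V -> R) (y : V) :
  (forall x z, nrm (x + z) <= nrm x + nrm z) ->
  (forall t x, nrm (sc t x) = `|t| * nrm x) ->
  exists u : V -> R, [/\ forall x z, u (x + z) = u x + u z,
    forall t x, u (sc t x) = t * u x, forall x, u x <= nrm x & u y = nrm y].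
Proof.
move=> nD nZ.
have sn : sublinear nrm by split=> // t x t0; rewrite nZ ger0_norm.
have [u [su uE uD]] := minimal_sublinear (directional_sublinear y sn).
have uN x : u (- x) = - u x.
  by apply/eqP; rewrite -addr_eq0 -uD addNr (sublinear0 su).
have un x : u x <= nrm x.
  by rewrite (le_trans (uE x))// directional_le_self.
exists u; split => //.
  move=> t x; have [t0|t0] := leP 0 t; first exact: su.2.
  have scN : sc (- t) x = - sc t x.
    by apply/eqP; rewrite -addr_eq0 -scDl addNr sc0.
  have := su.2 (- t) x; rewrite scN uN oppr_ge0 => /(_ (ltW t0)); lra.
apply/le_anti; rewrite un/=.
have := uE (- y); have := directional_le y sn (- y) ler01.
by rewrite sc1 addNr (sublinear0 sn) uN; lra.
Qed.

End HahnBanach.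

(** * The real field *)

Section RealScalars.
Variable R : realType.

Lemma real_complete (F : set_system R) : ProperFilter F ->
  (forall e : R, 0 < e -> exists x, F [set y | `|y - x| <= e]) ->
  exists l, forall e : R, 0 < e -> F [set y | `|y - l| <= e].
Proof.
move=> FF H.
have cF : cauchy F.
  apply/cauchyP => e e0; have [|x Fx] := H (e / 2); first by rewrite divr_gt0.
  exists x; apply: filterS Fx => y /= xy; rewrite -ball_normE /= distrC; lra.
have cv : F --> lim F := cauchy_cvg F cF.
exists (lim F) => e e0; have : F (ball (lim F) e) by apply/cv/nbhsx_ballx.
by apply: filterS => y; rewrite -ball_normE /= distrC => /ltW.
Qed.

Lemma real_support (V : normedModType R) (y : V) :
  exists2 f : bounded_operator V R^o, `|f| <= 1 & f y = `|y|.
Proof.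
have [||||||u [uD uZ ule uy]] := @real_hahn_banach R V ( *:%R ) _ _ _ _ Num.norm y.
- by move=> t x z; rewrite scalerDr.
- by move=> t s x; rewrite scalerDl.
- by move=> t s x; rewrite scalerA.
- exact: scale1r.
- exact: ler_normD.
- by move=> t x; rewrite normrZ.
have linu : linear (u : V -> R^o) by move=> a x z; rewrite uD uZ.
have uN x : `|u x| <= `|x|.
  rewrite ler_norml ule andbT lerNl -mulN1r -uZ scaleN1r.
  by rewrite -(normrN x) ule.
have bu : (u : V -> R^o) \in @bounded_operator_pred R V R^o.
  by apply/asboolP; split=> //; exists 1 => x; rewrite mul1r; apply: uN.
exists (BoundedOperator bu); last exact: uy.
rewrite bounded_operator_normE; apply: operator_norm_le => x x1.
exact: le_trans (uN x) x1.
Qed.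

Definition real_scalars : scalars R R.
Proof.
apply: (@Scalars R R idfun).
- by [].
- by move=> x _; exists x.
- exact: real_complete.
- exact: real_support.
Defined.

End RealScalars.

(** * The complex field *)

Section ComplexScalars.
Variable R : realType.
Local Open Scope complex_scope.
Local Notation Re := (@complex.Re R).
Local Notation Im := (@complex.Im R).

Let ReB (x y : R[i]) : Re (x - y) = Re x - Re y.
Proof. by case: x y => [a b] [c d]. Qed.

Let ImB (x y : R[i]) : Im (x - y) = Im x - Im y.
Proof. by case: x y => [a b] [c d]. Qed.

Let normi : `|'i| = 1 :> R[i].
Proof. by rewrite normc_def /= expr0n expr1n add0r sqrtr1. Qed.

Lemma norm_real_complex (a : R) : `|a%:C| = `|a|%:C.
Proof. by rewrite normc_def /= expr0n addr0 sqrtr_sqr. Qed.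

Lemma normc_ge_Im (x : R[i]) : `|Im x|%:C <= `|x|.
Proof.
have := normc_ge_Re (x * 'i); rewrite ReiNIm normrN normrM.
by rewrite normi mulr1.
Qed.

Lemma normc_le (x : R[i]) : `|x| <= (`|Re x| + `|Im x|)%:C.
Proof.
rewrite {1}(complexE x) (le_trans (ler_normD _ _))// normrM normi mul1r.
by rewrite !norm_real_complex -rmorphD.
Qed.

Lemma complex_complete (F : set_system R[i]) : ProperFilter F ->
  (forall e : R, 0 < e -> exists x, F [set y | `|y - x| <= e%:C]) ->
  exists l, forall e : R, 0 < e -> F [set y | `|y - l| <= e%:C].
Proof.
move=> FF H.
have part (f : R[i] -> R) : (forall x y, `|f y - f x|%:C <= `|y - x|) ->
    exists l, forall e : R, 0 < e -> F [set y | `|f y - l| <= e].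
  move=> Hf.
  have [|l Hl] := @real_complete R (fmap f F) _; last by exists l.
  move=> e /H[x Fx]; exists (f x); rewrite /fmap /=; apply: filterS Fx => y /= yx.
  by rewrite -lecR (le_trans (Hf x y)).
have [|a Ha] := part Re.
- by move=> x y; rewrite -ReB normc_ge_Re.
have [|b Hb] := part Im.
- by move=> x y; rewrite -ImB normc_ge_Im.
exists (a +i* b) => e e0; have e2 : 0 < e / 2 by rewrite divr_gt0.
apply: filterS (filterI (Ha _ e2) (Hb _ e2)) => y /= [ya yb].
rewrite (le_trans (normc_le _))// lecR ReB ImB /= [e]splitr; exact: lerD.
Qed.

Lemma complex_support (V : normedModType R[i]) (y : V) :
  exists2 f : bounded_operator V (R[i])^o, `|f| <= 1 & f y = `|y|.
Proof.
have nE (x : V) : `|x| = (Re `|x|)%:C by rewrite RRe_real// normr_real.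
have [||||||u [uD uZ ule uy]] :=
    @real_hahn_banach R V (fun t x => t%:C *: x) _ _ _ _ (fun x => Re `|x|) y.
- by move=> t x z; rewrite scalerDr.
- by move=> t s x; rewrite rmorphD scalerDl.
- by move=> t s x; rewrite rmorphM scalerA.
- by move=> x; rewrite rmorph1 scale1r.
- by move=> x z; rewrite -lecR rmorphD /= -!nE ler_normD.
- by move=> t x; apply: complexI; rewrite rmorphM /= -!nE normrZ norm_real_complex.
(* The unique complex-linear functional with real part [u]. *)
pose f (x : V) : (R[i])^o := u x +i* - u ('i *: x).
have fD x z : f (x + z) = f x + f z.
  by apply/eqP; rewrite eq_complex /= scalerDr !uD opprD !eqxx.
have fR (t : R) x : f (t%:C *: x) = t%:C * f x.
  apply/eqP; rewrite eq_complex /=.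
  have -> : 'i *: (t%:C *: x) = t%:C *: ('i *: x) by rewrite !scalerA mulrC.
  by rewrite !uZ !mul0r subr0 addr0 mulrN !eqxx.
have fi x : f ('i *: x) = 'i * f x.
  have uN : u (- x) = - u x.
    by rewrite -scaleN1r -[- 1](rmorphN1 (real_complex R)) uZ mulN1r.
  apply/eqP; rewrite eq_complex /= scalerA -expr2 sqr_i scaleN1r uN.
  by rewrite !mul0r !mul1r sub0r add0r !opprK !eqxx.
have fZ a x : f (a *: x) = a * f x.
  by rewrite {1}(complexE a) scalerDl fD -scalerA fi !fR mulrA -mulrDl -complexE.
have linf : linear f by move=> a x z; rewrite fD fZ.
have Re_le (a b : R[i]) : 0 <= a -> 0 <= b -> Re a <= Re b -> a <= b.
  by move=> a0 b0 ab; rewrite lecE ab (ger0_Im a0) (ger0_Im b0) eqxx.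
have fle x : `|f x| <= `|x|.
  have [->|fx0] := eqVneq (f x) 0; first by rewrite normr0.
  (* After rotation of [x] by [w], the value of [f] is real and nonnegative, so it is a value of
     [u], where the real bound applies. *)
  pose w := `|f x| / f x.
  have w1 : `|w| = 1 by rewrite normrM normr_id normfV divff// normr_eq0.
  have fw : f (w *: x) = `|f x| by rewrite fZ divfK.
  apply: Re_le => //; have := ule (w *: x).
  by rewrite normrZ w1 mul1r -fw.
have bf : f \in @bounded_operator_pred R[i] V (R[i])^o.
  by apply/asboolP; split=> //; exists 1 => x; rewrite mul1r; apply: fle.
exists (BoundedOperator bf).
  rewrite bounded_operator_normE; apply: operator_norm_le => x x1.
  exact: le_trans (fle x) x1.
apply/eqP; rewrite eq_complex /= uy eqxx /= [X in _ == X]ger0_Im//.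
(* The real part of [f y] is already |y|, so this bound leaves no room for an imaginary part. *)
have h : `|f y : R[i]| <= (Re `|y|)%:C by rewrite -nE; apply: fle.
move: h; rewrite normc_def lecR /= uy sqrrN; set a := Re _; set b := u _ => h.
have ab : 0 <= a ^+ 2 + b ^+ 2 by rewrite addr_ge0 ?sqr_ge0.
have := sqr_sqrtr ab; have := sqrtr_ge0 (a ^+ 2 + b ^+ 2).
move: h; set s := Num.sqrt _ => h s0 sE.
have b2 : b ^+ 2 = 0 by apply/le_anti; rewrite sqr_ge0 andbT; nra.
by rewrite oppr_eq0 -sqrf_eq0 b2.
Qed.

Definition complex_scalars : scalars R R[i].
Proof.
apply: (@Scalars R R[i] (real_complex R)).
- exact: lecR.
- by move=> x x0; exists (Re x); apply/esym/RRe_real/ger0_real.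
- exact: complex_complete.
- exact: complex_support.
Defined.

End ComplexScalars.

(** * The lower bound for complex spaces *)

Section ComplexLowerBound.
Variable R : realType.
Local Open Scope complex_scope.
Local Notation S := (complex_scalars R).
Local Notation N := (rnorm S).

Lemma complex_prim_root n : (0 < n)%N -> exists w : R[i], n.-primitive_root w.
Proof.
move=> n0; pose p : {poly R[i]} := 'X^n - 1.
have [r Dp] := closed_field_poly_normal p.
rewrite (monicP _) ?monicXnsubC// scale1r in Dp.
have rn1 : all n.-unity_root r by apply/allP=> z; rewrite -root_prod_XsubC -Dp.
have sz_r : (n < (size r).+1)%N.
  by rewrite -(size_prod_XsubC r id) -Dp size_XnsubC.
have [|z _ zn] := hasP (has_prim_root n0 rn1 _ sz_r); last by exists z.
by rewrite -separable_prod_XsubC -Dp separable_Xn_sub_1// pnatr_eq0 -lt0n.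
Qed.

Lemma prim_root_sum n (w : R[i]) m : n.-primitive_root w ->
  \sum_(j < n) (w ^+ m) ^+ j = if (n %| m)%N then n%:R else 0.
Proof.
move=> wn; case: ifPn => nm.
  have -> : w ^+ m = 1 by apply/eqP; rewrite -(prim_order_dvd wn).
  under eq_bigr do rewrite expr1n.
  by rewrite sumr_const card_ord.
have wm : w ^+ m - 1 != 0 by rewrite subr_eq0 -(prim_order_dvd wn).
apply: (mulfI wm); rewrite mulr0 -subrX1 -exprM mulnC exprM.
by rewrite (prim_expr_order wn) expr1n subrr.
Qed.

Lemma rnorm_prim_root n (w : R[i]) k : (0 < n)%N -> n.-primitive_root w ->
  N (w ^+ k : (R[i])^o) = 1.
Proof.
move=> n0 wn; have NX (z : R[i]) l : N (z ^+ l : (R[i])^o) = N (z : (R[i])^o) ^+ l.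
  elim: l => [|l IH]; first by rewrite !expr0 rnorm1.
  by rewrite !exprS rnormM IH.
have : N (w : (R[i])^o) ^+ n = 1 by rewrite -NX (prim_expr_order wn) rnorm1.
by move/eqP; rewrite pexpr_eq1 ?rnorm_ge0// NX => /eqP ->; rewrite expr1n.
Qed.

Variable Y : normedModType R[i].
Variable T : bounded_operator Y Y.

Definition euler_step (z : R[i]) (x : Y) : Y := x + z *: T x.

(** Pascal's rule for the coefficient of z^k in (1 + z T)^n x. This polynomial replaces the operator
    exponential, so that Cauchy's estimate becomes a finite sum. *)
Fixpoint euler_coef (n : nat) (x : Y) (k : nat) : Y :=
  match n, k with
  | 0%N, 0%N => x
  | 0%N, _ => 0
  | n'.+1, 0%N => euler_coef n' x 0
  | n'.+1, k'.+1 => euler_coef n' x k'.+1 + T (euler_coef n' x k')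
  end.

Lemma euler_coef1 n x : euler_coef n x 1 = n%:R *: T x.
Proof.
have c0 m : euler_coef m x 0 = x by elim: m.
elim: n => [|n IH]; first by rewrite scale0r.
by rewrite /= IH c0 -natr1 scalerDl scale1r.
Qed.

(** The length [M] is free because the induction step uses the hypothesis at two lengths; the
    coefficients beyond [n] vanish. *)
Lemma iter_euler_step n z x M : (n < M)%N ->
  iter n (euler_step z) x = \sum_(k < M) z ^+ k *: euler_coef n x k.
Proof.
elim: n M => [|n IH] [//|M] nM.
  rewrite big_ord_recl expr0 scale1r big1 ?addr0// => k _.
  by rewrite scaler0.
rewrite iterS /euler_step {1}(IH M.+1 (ltnW nM)) (IH M nM) big_ord_recl /=.
rewrite [in RHS]big_ord_recl /= -addrA; congr (_ + _).
rewrite linear_sum scaler_sumr -big_split; apply: eq_bigr => k _ /=.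
by rewrite linearZ scalerA scalerDr -exprS.
Qed.

(* Cauchy's estimate for the first coefficient, on roots of unity. *)
Lemma euler_cauchy n x (r q : R) : (0 < n)%N -> 0 <= r ->
  (forall z : R[i], N (z : (R[i])^o) = r / n%:R ->
     N (iter n (euler_step z) x) <= q) -> r * N (T x) <= q.
Proof.
move=> n0 r0 Hq; have [w wn] := @complex_prim_root n.+1 isT.
pose rho := r / n%:R; pose zj j : R[i] := rho%:C * w ^+ j.
have NS (a : R) : N (a%:C : (R[i])^o) = `|a| by exact: (rnorm_emb S a).
have Nz j : N (zj j : (R[i])^o) = rho.
  by rewrite rnormM NS (rnorm_prim_root _ _ wn)// mulr1 ger0_norm// divr_ge0.
have rn : rho * n%:R = r by rewrite /rho divfK// pnatr_eq0 -lt0n.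
(* [w ^+ n] is the inverse of [w]. The polynomial has degree [n], so [n.+1] points isolate the
   coefficient of [z]: for [k <= n], [n.+1] divides [n + k] only if [k = 1]. *)
have E : \sum_(j < n.+1) (w ^+ n) ^+ j *: iter n (euler_step (zj j)) x
    = (n.+1%:R * r)%:C *: T x.
  under eq_bigr => j _ do rewrite (@iter_euler_step n (zj j) x n.+1)// scaler_sumr.
  rewrite exchange_big /=.
  have Ek (k : 'I_n.+1) : \sum_(j < n.+1)
      (w ^+ n) ^+ j *: (zj j ^+ k *: euler_coef n x k) =
      (rho%:C ^+ k * (if (n.+1 %| n + k)%N then n.+1%:R else 0)) *: euler_coef n x k.
    rewrite -(prim_root_sum _ wn) mulr_sumr scaler_suml; apply: eq_bigr => j _.
    rewrite scalerA; congr (_ *: _).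
    by rewrite /zj exprMn mulrCA exprD exprMn -!exprM [(j * k)%N]mulnC.
  rewrite (eq_bigr _ (fun k _ => Ek k)).
  have n1 : (1 < n.+1)%N by [].
  rewrite (bigD1 (Ordinal n1))//= big1 ?addr0; last first.
    move=> k k1; rewrite ifF ?mulr0 ?scale0r//; apply/negbTE/negP => /dvdnP[d dE].
    have kn := ltn_ord k; have {}k1 : nat_of_ord k != 1%N by apply: contra k1 => /eqP k1; apply/eqP/val_inj.
    have d0 : (0 < d)%N.
      rewrite lt0n; apply/eqP => d0; move/eqP: dE.
      by rewrite d0 mul0n addn_eq0 => /andP[/eqP n00 _]; rewrite n00 in n0.
    have d2 : (d < 2)%N.
      rewrite -(ltn_pmul2r (ltn0Sn n)) -dE mul2n -addnn addSn ltnS leq_add2l.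
      exact: ltnW.
    have d1 : d = 1%N by apply/eqP; rewrite eqn_leq d0 -ltnS d2.
    have /addnI kE : (n + k)%N = (n + 1)%N by rewrite dE d1 mul1n addn1.
    by rewrite kE in k1.
  rewrite addn1 dvdnn euler_coef1 scalerA; congr (_ *: _).
  have natC k : k%:R = (k%:R : R)%:C by rewrite (rmorph_nat (real_complex R)).
  by rewrite expr1 !natC -!rmorphM -rn; congr (_%:C); ring.
have n10 : 0 < n.+1%:R :> R by rewrite ltr0n.
rewrite -(ler_pM2l n10) mulrA.
have -> : n.+1%:R * r * N (T x) = N ((n.+1%:R * r)%:C *: T x).
  by rewrite rnormZ NS ger0_norm// mulr_ge0.
rewrite -E (le_trans (rnorm_sum _ _ _))// mulr_natl -[X in _ *+ X]card_ord -sumr_const.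
apply: ler_sum => j _; rewrite rnormZ -exprM (rnorm_prim_root _ _ wn)// mul1r.
exact: Hq.
Qed.

(** With |z| = 1 / (v n), one step multiplies norms by about 1 + 1 / n, so [n] steps cost about e;
    Cauchy's estimate at radius 1 / v then gives |T| <= v exp(1 + d) with [d] of order 1 / m. The
    summand [e] keeps [v] positive. *)
Lemma radius_exp_le (e : R) (m : nat) : 0 < e -> (0 < m)%N ->
  let v := rradius S T + e in
  N T = 1 -> (expR 1)^-1 - (v ^- 2 + 1) / m%:R <= v.
Proof.
move=> e0 m0 v T1; have vT := rradius_ge0 S T.
have v0 : 0 < v by rewrite /v; lra.
have M0 : 0 < m%:R :> R by rewrite ltr0n.
pose n := m.+1; have nE : n%:R = m%:R + 1 :> R by rewrite -natr1.
pose c := v ^- 2; have c0 : 0 <= c by rewrite invr_ge0 sqr_ge0.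
(* With [n = m + 1], 1 / (1 - 1 / n) is 1 + 1 / m; both factors of the step are then bounded through
   1 + x <= exp x. *)
pose s : R := c / n%:R ^+ 2 + m%:R^-1.
have n0 : 0 < n%:R :> R by rewrite ltr0n.
have step (z : R[i]) y : N (z : (R[i])^o) = v^-1 / n%:R ->
    N (euler_step z y) <= expR s * N y.
  move=> zE; have := perturb_le S T z y; rewrite zE T1 expr1n mulr1 -/(euler_step z y).
  set A := N (euler_step z y); set B := N y.
  have A0 : 0 <= A by apply: rnorm_ge0.
  have B0 : 0 <= B by apply: rnorm_ge0.
  have cE : (v^-1 / n%:R) ^+ 2 = c / n%:R ^+ 2 by rewrite expr_div_n exprVn.
  rewrite cE => h.
  have rv : v^-1 / n%:R * rradius S T <= n%:R^-1.
    rewrite mulrAC ler_piMl ?invr_ge0 ?ler0n// mulrC ler_pdivrMr// mul1r /v; lra.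
  have g1 : (1 - n%:R^-1) * A <= (1 + c / n%:R ^+ 2) * B.
    apply: le_trans h; rewrite ler_wpM2r//; lra.
  have g2 : A <= (1 + c / n%:R ^+ 2) * B * (1 + m%:R^-1).
    have -> : A = (1 - n%:R^-1) * A * (1 + m%:R^-1).
      by rewrite nE; field; rewrite !gt_eqF//; rewrite -nE.
    by rewrite ler_wpM2r// addr_ge0// invr_ge0 ltW.
  apply: (le_trans g2); rewrite mulrAC ler_wpM2r// /s expRD.
  apply: ler_pM; [| |exact: expR_ge1Dx|exact: expR_ge1Dx].
    by rewrite addr_ge0 ?ler01 ?divr_ge0 ?sqr_ge0.
  by rewrite addr_ge0 ?ler01 ?invr_ge0 ?ler0n.
have iter_le (z : R[i]) y l : N (z : (R[i])^o) = v^-1 / n%:R ->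
    N (iter l (euler_step z) y) <= expR s ^+ l * N y.
  move=> zE; elim: l => [|l IH]; first by rewrite expr0 mul1r.
  rewrite iterS (le_trans (step _ _ zE))// exprS -mulrA.
  by rewrite ler_wpM2l ?expR_ge0.
pose d := (c + 1) / m%:R.
have sn : expR s ^+ n <= expR (1 + d).
  rewrite -expRM_natr ler_expR /s /d.
  have -> : (c / n%:R ^+ 2 + m%:R^-1) * n%:R = c / n%:R + n%:R / m%:R.
    by field; rewrite !gt_eqF.
  have -> : n%:R / m%:R = 1 + m%:R^-1 :> R by rewrite nE; field; rewrite gt_eqF.
  have : c / n%:R <= c / m%:R.
    by rewrite ler_wpM2l// lef_pV2 ?posrE// ler_nat /n.
  by rewrite mulrDl mul1r; lra.
have vexp : N T <= v * expR (1 + d).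
  apply: oprnorm_le => x x1.
  have := @euler_cauchy n x v^-1 (expR (1 + d)) isT.
  rewrite invr_ge0 (ltW v0) => /(_ isT) H.
  rewrite -ler_pdivrMl//; apply: H => z zE.
  apply: (le_trans (iter_le z x n zE)); apply: le_trans sn.
  by rewrite ler_piMr ?exprn_ge0 ?expR_ge0.
rewrite T1 in vexp.
have {vexp} : expR (-1) * expR (- d) <= v.
  by rewrite -expRD -opprD expRN -[_^-1]mul1r ler_pdivrMr ?expR_gt0.
have := expR_ge1Dx (- d); have := expR_gt0 (- 1 : R).
have : expR (- 1) <= 1 :> R by rewrite -[X in _ <= X]expR0 ler_expR lerN10.
rewrite -expRN -/c -/d; have d0 : 0 <= d by rewrite divr_ge0// addr_ge0.
set E := expR (- 1); set D := expR (- d) => E1 E0 dD Ev.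
have : E * (1 - d) <= E * D by rewrite ler_wpM2l// ltW.
nra.
Qed.

Lemma euler_radius : N T = 1 -> (expR 1)^-1 <= rradius S T.
Proof.
move=> T1; apply/ler_addgt0Pr => e e0.
set v := rradius S T + e; apply/ler_addgt0Pr => h h0.
pose m := (Num.truncn ((v ^- 2 + 1) / h)).+1.
have := radius_exp_le e0 (ltn0Sn _ : 0 < m)%N T1; rewrite -/v.
have : (v ^- 2 + 1) / m%:R <= h.
  rewrite ler_pdivrMr ?ltr0n// mulrC -ler_pdivrMr// ltW// truncnS_gt//.
lra.
Qed.

End ComplexLowerBound.

Lemma rindex_complex_ge (R : realType) (Y : normedModType R[i]) :
  (exists y : Y, y != 0) -> (expR 1)^-1 <= rindex (complex_scalars R) Y.
Proof. by move=> Y0; apply: rindex_ge => // T; apply: euler_radius. Qed.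

(** * Conclusion *)

(** The one-sided estimate holds for both orders of [s] and [t], hence is a modulus of
    continuity. *)
Lemma real_intermediate_value (R : realType) (f : R -> R) (y : R) :
  (forall h, 0 < h -> h <= 2^-1 -> exists2 d, 0 < d &
     forall s t, `|t - s| <= d -> f t <= f s + 10 * h) ->
  f 1 <= y -> y <= f 0 -> exists t, f t = y.
Proof.
move=> fc f1y yf0.
have cf : continuous f.
  move=> s; apply/cvgrPdist_le => e e0.
  pose h := Num.min (2^-1) (e / 10).
  have h0 : 0 < h by rewrite lt_min; apply/andP; split; lra.
  have [h1 h2] : h <= 2^-1 /\ h <= e / 10 by split; rewrite ge_min lexx ?orbT.
  have [d d0 Hd] := fc h h0 h1.
  apply/nbhs_ballP; exists d => // t /=; rewrite /ball /= => /ltW st.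
  have := Hd s t; rewrite distrC => /(_ st).
  have := Hd t s st; rewrite ler_norml => ? ?; apply/andP; split; lra.
have [||t _ <-] := @IVT R f 0 1 y ler01; last by exists t.
  exact: continuous_subspaceT.
by rewrite ge_min le_max f1y yf0 orbT.
Qed.

Section AttainedValues.
Variables (R : realType) (K : supNumFieldType) (S : scalars R K) (I : choiceType).
Variables (a b : I -> K) (i0 i1 : I) (a1 b1 : R).
Local Notation N := (rnorm S).
Hypothesis a_le1 : forall i, N (a i : K^o) <= 1.
Hypothesis b_le1 : forall i, N (b i : K^o) <= 1.
Hypothesis i01 : i1 != i0.
Hypotheses (ai0 : a i0 = 1) (bi0 : b i0 = 0).
Hypotheses (ai1 : a i1 = S a1) (bi1 : b i1 = S b1).
Hypotheses (a1_ge0 : 0 <= a1) (b1_gt0 : 0 < b1).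
Variables (tau : K) (c m : R).
Hypothesis tau_le1 : N (tau : K^o) <= 1.
Hypothesis c_ge0 : 0 <= c.
Hypothesis b_le : forall i, N (b i : K^o) <= m.
Hypothesis swap_le : forall z : K, 0 < N (z : K^o) -> N (z : K^o) <= 2^-1 ->
  forall p q M, (forall i, N (a i * p + b i * q : K^o) <= M) ->
  forall i, N (a i * (p + z * q) + b i * (q + z * (tau * p)) : K^o)
              <= (1 + c * N (z : K^o) + 2 * N (z : K^o) ^+ 2) * M.

Lemma index_dual_attained (r : R) : c * m <= r -> r <= 1 ->
  exists X : completeNormedModType K,
    numerical_index X = 1 /\ S r = numerical_index (dual X).
Proof.
move=> cr r1.
pose J := path_frame a_le1 b_le1 i01 ai0 bi0 ai1 bi1 a1_ge0 b1_gt0.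
pose f t := rindex S (dual (xspace (J t))).
have [|||t ft] := @real_intermediate_value R f r.
- exact: rindex_dual_path_continuous.
- apply: le_trans cr; apply: (@rindex_dual_le _ _ S I (J 1) tau tau_le1 c m) => //.
  + exact: path_lin_pt.
  + by move=> i; rewrite path_snd1.
  + move=> z z0 z1 p q M HM i; rewrite /lin path_fst1 path_snd1.
    apply: swap_le => // j; have := HM j; rewrite /lin path_fst1 path_snd1; exact.
- by rewrite /f rindex_dual_path0.
exists (xspace_banach (J t)); split.
  by rewrite (rindexE S) rindex_xspace rmorph1.
by rewrite (rindexE S) -ft.
Qed.

End AttainedValues.

(** * Euclidean weights: all values in the real case *)

Section RealValues.
Variable R : realType.
Local Notation S := (real_scalars R).
Local Notation N := (rnorm S).

Lemma rnorm_real (x : R) : N (x : R^o) = `|x|.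
Proof. exact: (rnorm_emb S x). Qed.

Definition unit_circle : Type := {w : R * R | w.1 ^+ 2 + w.2 ^+ 2 == 1}.
HB.instance Definition _ := Choice.on unit_circle.

Lemma real_attained (r : R) : 0 <= r <= 1 ->
  exists X : completeNormedModType R,
    numerical_index X = 1 /\ r = numerical_index (dual X).
Proof.
move=> /andP[r0 r1].
have p0 : (1 : R, 0 : R).1 ^+ 2 + (1 : R, 0 : R).2 ^+ 2 == 1.
  by rewrite /= expr1n expr0n addr0.
have p1 : (0 : R, 1 : R).1 ^+ 2 + (0 : R, 1 : R).2 ^+ 2 == 1.
  by rewrite /= expr1n expr0n add0r.
pose i0 : unit_circle := exist _ (1, 0) p0.
pose i1 : unit_circle := exist _ (0, 1) p1.
pose a (w : unit_circle) : R := (val w).1.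
pose b (w : unit_circle) : R := (val w).2.
have sq1 (x y : R) : x ^+ 2 + y ^+ 2 = 1 -> `|x| <= 1.
  move=> xy; rewrite ler_norml; apply/andP.
  by have := sqr_ge0 y; split; nra.
have a_le1 i : N (a i : R^o) <= 1.
  by rewrite rnorm_real; apply: (sq1 _ (b i)); apply/eqP/(valP i).
have b_le1 i : N (b i : R^o) <= 1.
  by rewrite rnorm_real; apply: (sq1 _ (a i)); rewrite addrC; apply/eqP/(valP i).
apply: (@index_dual_attained R R S unit_circle a b i0 i1 0 1
  a_le1 b_le1 _ _ _ _ _ _ _ (-1) 0 1) => //.
- by apply/eqP => /(congr1 (fun w : unit_circle => (val w).1)) /= /esym/eqP; rewrite oner_eq0.
- by rewrite rnorm_real normrN1.
- move=> z _ _ p q M HM w; rewrite !rnorm_real mul0r addr0.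
  set u := a w; set v := b w.
  have uv : u ^+ 2 + v ^+ 2 = 1 by apply/eqP/(valP w).
  (* The map (p, q) |-> (p + z q, q - z p) is [k] times a rotation, which moves the weight to
     another point of the circle; [k] has no linear term in [z], whence [c = 0]. *)
  pose k := Num.sqrt (1 + z ^+ 2).
  have k0 : 0 < k by rewrite sqrtr_gt0 ltr_pwDl// sqr_ge0.
  have k2 : k ^+ 2 = 1 + z ^+ 2 by rewrite sqr_sqrtr// addr_ge0// sqr_ge0.
  have w'P : ((u - z * v) / k, (v + z * u) / k).1 ^+ 2
      + ((u - z * v) / k, (v + z * u) / k).2 ^+ 2 == 1.
    rewrite /= !expr_div_n -mulrDl k2.
    have -> : (u - z * v) ^+ 2 + (v + z * u) ^+ 2 = (u ^+ 2 + v ^+ 2) * (1 + z ^+ 2) by ring.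
    by rewrite uv mul1r divff// -k2 gt_eqF// exprn_gt0.
  pose on_circle (x : R * R) := x.1 ^+ 2 + x.2 ^+ 2 == 1.
  have := HM (exist on_circle _ w'P); rewrite rnorm_real /a /b /= => h.
  have -> : u * (p + z * q) + v * (q + z * (-1 * p)) =
      k * ((u - z * v) / k * p + (v + z * u) / k * q) by field; rewrite gt_eqF.
  rewrite normrM (gtr0_norm k0).
  have M0 : 0 <= M := le_trans (normr_ge0 _) h.
  apply: ler_pM => //; first exact: ltW.
  rewrite real_normK ?num_real//.
  have := sqr_ge0 z; nra.
- by rewrite mul0r.
Qed.

End RealValues.

(** * Exponential weights: all values in the complex case *)

Section ComplexValues.
Variable R : realType.
Local Open Scope complex_scope.
Local Notation S := (complex_scalars R).
Local Notation N := (rnorm S).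

Lemma complex_attained (r : R) : (expR 1)^-1 <= r <= 1 ->
  exists X : completeNormedModType R[i],
    numerical_index X = 1 /\ r%:C = numerical_index (dual X).
Proof.
move=> /andP[r0 r1].
have NS (x : R) : N (x%:C : (R[i])^o) = `|x| by exact: (rnorm_emb S x).
pose rho (w : R[i]) : R := expR (- N (w : (R[i])^o)).
have rho0 w : 0 < rho w by apply: expR_gt0.
pose a (w : R[i]) : R[i] := (rho w)%:C.
pose b (w : R[i]) : R[i] := (rho w)%:C * w.
have Na w : N (a w : (R[i])^o) = rho w by rewrite NS gtr0_norm.
have b_le w : N (b w : (R[i])^o) <= (expR 1)^-1.
  rewrite rnormM NS gtr0_norm// /rho; set x := N _.
  (* x <= exp(x - 1) is the bound x exp(-x) <= 1/e. *)
  have := expR_ge1Dx (x - 1); rewrite addrC subrK => h.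
  rewrite mulrC (le_trans (ler_wpM2r (ltW (rho0 w)) h))// /rho -/x -expRD.
  by rewrite addrAC subrr add0r expRN.
have e1 : (expR 1)^-1 <= 1 :> R.
  by rewrite -expRN -[X in _ <= X]expR0 ler_expR lerN10.
have a_le1 w : N (a w : (R[i])^o) <= 1.
  by rewrite Na -[X in _ <= X]expR0 ler_expR oppr_le0 rnorm_ge0.
have b_le1 w : N (b w : (R[i])^o) <= 1 := le_trans (b_le w) e1.
apply: (@index_dual_attained R R[i] S R[i] a b 0 1 (rho 1) (rho 1)
  a_le1 b_le1 _ _ _ _ _ _ _ 0 1 (expR 1)^-1) => //.
- by rewrite /a /rho rnorm0 oppr0 expR0.
- by rewrite /b mulr0.
- by rewrite /b mulr1.
- exact: ltW.
- by rewrite rnorm0.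
- move=> z z0 z1 p q M HM w; rewrite !mul0r mulr0 addr0 mul1r.
  (* Up to the weight, the moved pair (p + z q, q) has at [w] the value of (p, q) at [w + z], and
     the two weights differ by a factor of at most exp |z|. *)
  have := HM (w + z); rewrite /a /b.
  have E (y : R[i]) p' q' : (rho y)%:C * p' + (rho y)%:C * y * q' =
      (rho y)%:C * (p' + y * q') by ring.
  rewrite !E !rnormM !NS !gtr0_norm//.
  have -> : p + z * q + w * q = p + (w + z) * q by ring.
  set A := N _; set s := N _ in z0 z1 * => h.
  have A0 : 0 <= A by apply: rnorm_ge0.
  have rw : rho w <= expR s * rho (w + z).
    rewrite /rho -expRD ler_expR; have := ler_rnormD S (w : (R[i])^o) z.
    by rewrite -/s; lra.
  have M0 : 0 <= M by apply: le_trans h; rewrite mulr_ge0// ltW.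
  (* exp s <= 1 / (1 - s) <= 1 + s + 2 s^2 for s <= 1/2; both constants of [swap_le] come from
     here. *)
  have es : expR s <= 1 + s + 2 * s ^+ 2.
    have := expR_ge1Dx (- s); rewrite expRN => h1.
    have := expR_gt0 s; set E' := expR s in h1 * => E0.
    have : (1 - s) * E' <= 1.
      by rewrite -ler_pdivlMr// mul1r.
    have : 0 <= s ^+ 2 * (1 - 2 * s) by rewrite mulr_ge0 ?sqr_ge0//; lra.
    nra.
  apply: (@le_trans _ _ (expR s * M)); last by rewrite ler_wpM2r.
  apply: (@le_trans _ _ (expR s * rho (w + z) * A)); first by rewrite ler_wpM2r.
  by rewrite -mulrA ler_wpM2l// expR_ge0.
- by rewrite mul1r.
Qed.

End ComplexValues.

Unset Implicit Arguments.
Set Strict Implicit.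
Set Printing Implicit Defensive.

Theorem proposition4p2 (R : realType) :
  [set l : R[i] | exists X : completeNormedModType R[i],
      numerical_index X = 1 /\ l = numerical_index (dual X)]
    = [set r%:C | r in [set` `[(expR 1)^-1, 1 : R]]] /\
  [set l : R | exists X : completeNormedModType R,
      numerical_index X = 1 /\ l = numerical_index (dual X)]
    = [set` `[0, 1 : R]].
Proof.
split; apply/seteqP; split.
- move=> l [X [X1 ->]]; rewrite (rindexE (complex_scalars R)).
  exists (rindex (complex_scalars R) (dual X)) => //=.
  rewrite in_itv /= rindex_le1 andbT; apply: rindex_complex_ge.
  (* The lower bound requires a nonzero dual, which index 1 guarantees: the zero space has index 0
     by convention. *)
  apply: (rindex_gt0_dual (S := complex_scalars R)).
  rewrite (rindexE (complex_scalars R)) -(rmorph1 (complex_scalars R)) in X1.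
  by rewrite (emb_inj X1) ltr01.
- move=> _ [r /= + <-]; rewrite in_itv /= => rP.
  by have [X [X1 XE]] := complex_attained rP; exists X.
- move=> l [X [X1 ->]]; rewrite (rindexE (real_scalars R)) /=.
  by rewrite in_itv /= rindex_ge0 rindex_le1.
- move=> r /=; rewrite in_itv /= => rP.
  by have [X [X1 XE]] := real_attained rP; exists X.
Qed.
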